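(* Let $n\ge 0$ and let $\underline{A}=(A,\mathfrak p_n,\dots,\mathfrak p_0)$ be a regular chain of length $n$. Then $HL(\underline A)$ is a field of $\operatorname{cdvdim}\ge n$. Moreover, its $n$-th residue field is $k(A)=A/\mathfrak p_n$.
   Context: A complete discrete valuation field is a field $F$ which is complete with respect to some discrete valuation $F^\times\to\mathbb Z$; the surjective such valuation is then unique, and $\overline F$ denotes the residue field. The complete discrete valuation dimension is defined recursively: $\operatorname{cdvdim}F=0$ if $F$ is not a complete discrete valuation field, and $\operatorname{cdvdim}F=\operatorname{cdvdim}\overline F+1$ if it is ($\infty$ if the process never terminates). If $\operatorname{cdvdim}F\ge n$, the residue fields are $F^{(0)}=F$ and $F^{(i+1)}=\overline{F^{(i)}}$, and $F^{(i)}$ is called the $i$-th residue field ($0\le i\le n$). A regular chain of length $n$ (regular $n$-chain) is a tuple $\underline A=(A,\mathfrak p_n,\dots,\mathfrak p_0)$ where $A$ is a Noetherian, $n$-dimensional, regular local ring and $\mathfrak p_n\supset\mathfrak p_{n-1}\supset\dots\supset\mathfrak p_0$ is a strictly decreasing chain of prime ideals of $A$ such that each $A/\mathfrak p_i$ is a regular local ring (so $\mathfrak p_n$ is the maximal ideal and $\mathfrak p_0=0$). Put $k(\underline A)=k(A)=A/\mathfrak p_n$. Completion: $\operatorname{comp}\underline A=(\widehat A,\mathfrak p_n\widehat A,\dots,\mathfrak p_0\widehat A)$, where $\widehat A$ is the $\mathfrak p_n$-adic completion; this is again a regular $n$-chain. Localisation (for $n\ge1$): $\operatorname{loc}\underline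 A=(A_{\mathfrak p_{n-1}},\mathfrak p_{n-1}A_{\mathfrak p_{n-1}},\dots,\mathfrak p_0A_{\mathfrak p_{n-1}})$; this is a regular $(n-1)$-chain. A regular chain of length $0$, $(F,0)$, is identified with the field $F$. Then $HL(\underline A):=(\operatorname{loc}\operatorname{comp})^n\underline A$ (the operation ''complete, then localise'' applied $n$ times), a regular chain of length $0$. *)

(* Defs.v *)
From HB Require Import structures.
From mathcomp Require Import all_boot all_order all_algebra.
From mathcomp Require Import all_classical.
From mathcomp Require Import ring.

Set Implicit Arguments.
Unset Strict Implicit.
Unset Printing Implicit Defensive.

Import Order.TTheory GRing.Theory Num.Theory.
Local Open Scope classical_set_scope.
Local Open Scope ring_scope.
Local Open Scope quotient_scope.

(* Rings are [comPzRingType]s, i.e. the zero ring is allowed, so that         *)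
(* quotients, completions and localisations are total operations.  For the    *)
(* same reason ideals need not be proper, contrary to the [idealr] structure  *)
(* of [ring_quotient]. "Field" is then a property of a ring.                  *)

Definition is_field (F : comPzRingType) : Prop :=
  (1 : F) <> 0 /\ forall x : F, x <> 0 -> exists y : F, x * y = 1.

Definition ring_iso (A B : comPzRingType) : Prop :=
  exists f : {rmorphism A -> B}, bijective f.

Record ideal (A : comPzRingType) := Ideal {
  ideal_set :> A -> Prop;
  ideal0 : ideal_set 0;
  idealD : forall x y, ideal_set x -> ideal_set y -> ideal_set (x + y);
  idealM : forall a x, ideal_set x -> ideal_set (a * x) }.

Section IdealGen.
Variable A : comPzRingType.

Definition gen_set (S : set A) : set A :=
  [set x | forall I : ideal A, S `<=` I -> I x].

Lemma gen_set0 S : gen_set S 0.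
Proof. by move=> I _; apply: ideal0. Qed.

Lemma gen_setD S x y : gen_set S x -> gen_set S y -> gen_set S (x + y).
Proof. by move=> Sx Sy I SI; apply: idealD; [apply: Sx | apply: Sy]. Qed.

Lemma gen_setM S a x : gen_set S x -> gen_set S (a * x).
Proof. by move=> Sx I SI; apply: idealM; apply: Sx. Qed.

Definition ideal_gen (S : set A) : ideal A :=
  Ideal (@gen_set0 S) (@gen_setD S) (@gen_setM S).

Fixpoint ideal_pow (I : ideal A) (k : nat) : ideal A :=
  if k is j.+1 then ideal_gen [set x * y | x in I & y in ideal_pow I j]
  else ideal_gen [set: A].

Lemma idealN (I : ideal A) x : I x -> I (- x).
Proof. by move=> Ix; rewrite -mulN1r; apply: idealM. Qed.

Lemma idealB (I : ideal A) x y : I x -> I y -> I (x - y).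
Proof. by move=> Ix Iy; apply: idealD => //; apply: idealN. Qed.

Definition prime_ideal (P : ideal A) : Prop :=
  ~ P 1 /\ forall x y, P (x * y) -> P x \/ P y.

Definition maximal_ideal (M : ideal A) : Prop :=
  ~ M 1 /\ forall J : ideal A, M `<=` J -> ~ J 1 -> J `<=` M.

Definition is_local (M : ideal A) : Prop :=
  maximal_ideal M /\ forall J : ideal A, maximal_ideal J -> J = M :> set A.

Definition noetherian : Prop :=
  forall I : ideal A, exists s : seq A, I = ideal_gen [set` s] :> set A.

Definition has_prime_chain (d : nat) : Prop :=
  exists p : 'I_d.+1 -> ideal A,
    (forall i, prime_ideal (p i)) /\
    (forall i j : 'I_d.+1, (i < j)%N -> p i `<` p j).

Definition krull_dim (d : nat) : Prop :=
  has_prime_chain d /\ forall e, has_prime_chain e -> (e <= d)%N.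

Definition regular_local : Prop :=
  noetherian /\
  exists (M : ideal A) (d : nat),
    [/\ is_local M, krull_dim d &
        exists s : d.-tuple A, M = ideal_gen [set` s] :> set A].

End IdealGen.

Definition ideal_ext (A B : comPzRingType) (f : A -> B) (I : ideal A) :
  ideal B := ideal_gen (f @` I).

Section QuotientRing.
Variables (A : comPzRingType) (I : ideal A).

Definition ideal_pred : A -> bool := fun x => `[< I x >].

Lemma ideal_pred_closed : zmod_closed ideal_pred.
Proof.
split; first by apply/asboolP; apply: ideal0.
by move=> x y /asboolP Ix /asboolP Iy; apply/asboolP; apply: idealB.
Qed.

HB.instance Definition _ := GRing.isZmodClosed.Build A ideal_pred
  ideal_pred_closed.

Definition quotient_ring := Quotient.quot (GRing.ZmodClosed.clone A ideal_pred _).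

HB.instance Definition _ := Choice.on quotient_ring.
HB.instance Definition _ := GRing.Zmodule.on quotient_ring.
HB.instance Definition _ := ZmodQuotient.on quotient_ring.

Definition quotient_one : quotient_ring := lift_cst quotient_ring 1.
Definition quotient_mul := lift_op2 quotient_ring *%R.

Canonical pi_quotient_one := PiConst quotient_one.

Lemma quotient_eqP x y :
  reflect (I (x - y)) (x == y %[mod quotient_ring]).
Proof. by rewrite piE /Quotient.equiv; apply: (iffP (asboolP _)). Qed.

Lemma pi_quotient_mul : {morph \pi_quotient_ring : x y / x * y >-> quotient_mul x y}.
Proof.
move=> x y; unlock quotient_mul; apply/eqP/quotient_eqP.
set x' := repr _; set y' := repr _.
have Ix : I (x - x') by apply/quotient_eqP; rewrite reprK.
have Iy : I (y - y') by apply/quotient_eqP; rewrite reprK.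
have -> : x * y - x' * y' = y * (x - x') + x' * (y - y').
  by rewrite !mulrBr (mulrC y x) (mulrC y x') addrA subrK.
by apply: idealD; apply: idealM.
Qed.
Canonical pi_quotient_mul_morph := PiMorph2 pi_quotient_mul.

Lemma quotient_mulA : associative quotient_mul.
Proof. by move=> x y z; rewrite -[x]reprK -[y]reprK -[z]reprK !piE mulrA. Qed.

Lemma quotient_mulC : commutative quotient_mul.
Proof. by move=> x y; rewrite -[x]reprK -[y]reprK !piE mulrC. Qed.

Lemma quotient_mul1 : left_id quotient_one quotient_mul.
Proof. by move=> x; rewrite -[x]reprK !piE mul1r. Qed.

Lemma quotient_mulDl : left_distributive quotient_mul +%R.
Proof.
by move=> x y z; rewrite -[x]reprK -[y]reprK -[z]reprK !piE mulrDl.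
Qed.

HB.instance Definition _ := GRing.Zmodule_isComPzRing.Build quotient_ring
  quotient_mulA quotient_mulC quotient_mul1 quotient_mulDl.

Definition quotient_map (x : A) : quotient_ring := \pi_quotient_ring x.

Lemma quotient_map_zmod : zmod_morphism quotient_map.
Proof. by move=> x y; rewrite /quotient_map !piE. Qed.

Lemma quotient_map_monoid : monoid_morphism quotient_map.
Proof. by split=> [|x y]; [exact: lock | rewrite /quotient_map !piE]. Qed.

HB.instance Definition _ :=
  GRing.isZmodMorphism.Build A quotient_ring quotient_map quotient_map_zmod.
HB.instance Definition _ :=
  GRing.isMonoidMorphism.Build A quotient_ring quotient_map quotient_map_monoid.

End QuotientRing.

Section Completion.
Variables (A : comPzRingType) (I : ideal A).

Definition cauchy (u : nat -> A) : bool :=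
  `[< forall k, exists N, forall i j,
        (N <= i)%N -> (N <= j)%N -> ideal_pow I k (u i - u j) >].

Lemma cauchy_closed : subring_closed cauchy.
Proof.
split.
- by apply/asboolP => k; exists 0 => i j _ _; rewrite subrr; apply: ideal0.
- move=> u v /asboolP uC /asboolP vC; apply/asboolP => k.
  have [N Nu] := uC k; have [M Mv] := vC k; exists (maxn N M) => i j.
  rewrite !geq_max => /andP[Ni Mi] /andP[Nj Mj].
  have -> : (u - v) i - (u - v) j = (u i - u j) - (v i - v j).
    by rewrite !opprD !opprK addrACA.
  by apply: idealB; [apply: Nu | apply: Mv].
- move=> u v /asboolP uC /asboolP vC; apply/asboolP => k.
  have [N Nu] := uC k; have [M Mv] := vC k; exists (maxn N M) => i j.
  rewrite !geq_max => /andP[Ni Mi] /andP[Nj Mj].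
  have -> : (u * v) i - (u * v) j = v i * (u i - u j) + u j * (v i - v j).
    by rewrite !mulrBr (mulrC (v i) (u i)) (mulrC (v i) (u j)) addrA subrK.
  by apply: idealD; apply: idealM; [apply: Nu | apply: Mv].
Qed.

Record cauchy_seq := CauchySeq {
  cauchy_fun :> nat -> A;
  cauchy_funP : cauchy cauchy_fun }.

HB.instance Definition _ := [isSub for cauchy_fun].
HB.instance Definition _ := [Choice of cauchy_seq by <:].
HB.instance Definition _ :=
  GRing.SubChoice_isSubComPzRing.Build (nat -> A) cauchy cauchy_seq
    cauchy_closed.

Definition null_seq (u : cauchy_seq) : Prop :=
  forall k, exists N, forall i, (N <= i)%N -> ideal_pow I k (u i).

Lemma null_seq0 : null_seq 0.
Proof. by move=> k; exists 0 => i _; apply: ideal0. Qed.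

Lemma null_seqD u v : null_seq u -> null_seq v -> null_seq (u + v).
Proof.
move=> u0 v0 k; have [N Nu] := u0 k; have [M Mv] := v0 k.
exists (maxn N M) => i; rewrite geq_max => /andP[Ni Mi].
by apply: idealD; [apply: Nu | apply: Mv].
Qed.

Lemma null_seqM a u : null_seq u -> null_seq (a * u).
Proof.
move=> u0 k; have [N Nu] := u0 k.
by exists N => i Ni; apply: idealM; apply: Nu.
Qed.

Definition null_ideal : ideal cauchy_seq :=
  Ideal null_seq0 null_seqD null_seqM.

Definition completion : comPzRingType := quotient_ring null_ideal.

Lemma cauchy_cst (x : A) : cauchy (fun=> x).
Proof. by apply/asboolP => k; exists 0 => i j _ _; rewrite subrr; apply: ideal0. Qed.

Definition to_completion (x : A) : completion :=
  quotient_map null_ideal (CauchySeq (cauchy_cst x)).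

Lemma to_completion_zmod : zmod_morphism to_completion.
Proof.
move=> x y; rewrite /to_completion -rmorphB; congr (quotient_map _ _).
exact: val_inj.
Qed.

Lemma to_completion_monoid : monoid_morphism to_completion.
Proof.
split=> [|x y]; rewrite /to_completion -?rmorphM -?(rmorph1 (quotient_map _));
  by congr (quotient_map _ _); apply: val_inj.
Qed.

HB.instance Definition _ :=
  GRing.isZmodMorphism.Build A completion to_completion to_completion_zmod.
HB.instance Definition _ :=
  GRing.isMonoidMorphism.Build A completion to_completion to_completion_monoid.

End Completion.

(* Localisation at an arbitrary set S of denominators: fractions are formed   *)
(* over the multiplicative closure of S, which is S itself when S is the      *)
(* complement of a prime ideal (see [mul_closure_prime]).                     *)
Section Localization.
Variables (A : comPzRingType) (S : set A).

Definition mul_closure : set A :=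
  [set x | forall M : set A, M 1 -> S `<=` M ->
             (forall y z, M y -> M z -> M (y * z)) -> M x].

Lemma mul_closure1 : mul_closure 1. Proof. by []. Qed.

Lemma mul_closureM x y :
  mul_closure x -> mul_closure y -> mul_closure (x * y).
Proof. by move=> Sx Sy M M1 SM MM; apply: (MM); [apply: Sx | apply: Sy]. Qed.

Record fraction := Fraction {
  fnum : A;
  fden : A;
  fdenP : `[< mul_closure fden >] }.

HB.instance Definition _ := gen_eqMixin fraction.
HB.instance Definition _ := gen_choiceMixin fraction.

Lemma fden_closure (f : fraction) : mul_closure (fden f).
Proof. by apply/asboolP; apply: fdenP. Qed.

Definition frac (a s : A) (Ss : mul_closure s) : fraction :=
  @Fraction a s (asboolT Ss).

Definition equivf (f g : fraction) : bool :=
  `[< exists2 u, mul_closure u & u * (fnum f * fden g - fnum g * fden f) = 0 >].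

Lemma equivf_is_equiv : equiv_class_of equivf.
Proof.
have symf f g : equivf f g -> equivf g f.
  move=> /asboolP[u Su fg]; apply/asboolP; exists u => //.
  by rewrite -opprB mulrN fg oppr0.
split=> [f|f g|g f h fg gh].
- by apply/asboolP; exists 1; [apply: mul_closure1 | rewrite subrr mulr0].
- by apply/idP/idP; apply: symf.
move: fg gh => /asboolP[u Su uE] /asboolP[w Sw wE]; apply/asboolP.
exists (u * w * fden g).
  by do 2?apply: mul_closureM => //; apply: fden_closure.
case: f g h uE wE => [a s ?] [b t ?] [c r ?] /= uE wE.
have -> : u * w * t * (a * r - c * s) =
  w * r * (u * (a * t - b * s)) + u * s * (w * (b * r - c * t)). by ring.
by rewrite uE wE !mulr0 addr0.
Qed.

Canonical equivf_equiv := EquivRelPack equivf_is_equiv.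
Canonical equivf_encModRel := defaultEncModRel equivf.

Definition localization := {eq_quot equivf}.

HB.instance Definition _ := EqQuotient.on localization.
HB.instance Definition _ := Choice.on localization.

Lemma localization_eqP (f g : fraction) :
  reflect (exists2 u, mul_closure u & u * (fnum f * fden g - fnum g * fden f) = 0)
          (f == g %[mod localization]).
Proof. by rewrite piE; apply: asboolP. Qed.

Definition frac0 := frac 0 mul_closure1.
Definition frac1 := frac 1 mul_closure1.
Definition fopp (f : fraction) := frac (- fnum f) (fden_closure f).
Definition fadd (f g : fraction) :=
  frac (fnum f * fden g + fnum g * fden f)
    (mul_closureM (fden_closure f) (fden_closure g)).
Definition fmul (f g : fraction) :=
  frac (fnum f * fnum g) (mul_closureM (fden_closure f) (fden_closure g)).

Definition loc0 : localization := lift_cst localization frac0.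
Definition loc1 : localization := lift_cst localization frac1.
Definition locopp := lift_op1 localization fopp.
Definition locadd := lift_op2 localization fadd.
Definition locmul := lift_op2 localization fmul.

Canonical pi_loc0 := PiConst loc0.
Canonical pi_loc1 := PiConst loc1.

Lemma pi_locopp : {morph \pi_localization : f / fopp f >-> locopp f}.
Proof.
move=> f; unlock locopp; apply/eqP/localization_eqP.
have /localization_eqP[u Su] :
  f == repr (\pi_localization f) %[mod localization] by rewrite reprK.
move: (repr _) => f' uE; exists u => //=.
by apply: etrans (_ : - (u * (fnum f * fden f' - fnum f' * fden f)) = 0);
  [ring | rewrite uE oppr0].
Qed.
Canonical pi_locopp_morph := PiMorph1 pi_locopp.

Lemma pi_locadd : {morph \pi_localization : f g / fadd f g >-> locadd f g}.
Proof.
move=> f g; unlock locadd; apply/eqP/localization_eqP.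
have /localization_eqP[u Su] :
  f == repr (\pi_localization f) %[mod localization] by rewrite reprK.
have /localization_eqP[w Sw] :
  g == repr (\pi_localization g) %[mod localization] by rewrite reprK.
move: (repr (\pi_localization g)) (repr (\pi_localization f)) => g' f' wE uE.
exists (u * w); first exact: mul_closureM.
move: wE uE; case: f f' g g' => [a s ?] [a' s' ?] [b t ?] [b' t' ?] /= wE uE.
apply: etrans (_ : w * t * t' * (u * (a * s' - a' * s)) +
                   u * s * s' * (w * (b * t' - b' * t)) = 0); first by ring.
by rewrite uE wE !mulr0 addr0.
Qed.
Canonical pi_locadd_morph := PiMorph2 pi_locadd.

Lemma pi_locmul : {morph \pi_localization : f g / fmul f g >-> locmul f g}.
Proof.
move=> f g; unlock locmul; apply/eqP/localization_eqP.
have /localization_eqP[u Su] :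
  f == repr (\pi_localization f) %[mod localization] by rewrite reprK.
have /localization_eqP[w Sw] :
  g == repr (\pi_localization g) %[mod localization] by rewrite reprK.
move: (repr (\pi_localization g)) (repr (\pi_localization f)) => g' f' wE uE.
exists (u * w); first exact: mul_closureM.
move: wE uE; case: f f' g g' => [a s ?] [a' s' ?] [b t ?] [b' t' ?] /= wE uE.
apply: etrans (_ : w * b * t' * (u * (a * s' - a' * s)) +
                   u * s * a' * (w * (b * t' - b' * t)) = 0); first by ring.
by rewrite uE wE !mulr0 addr0.
Qed.
Canonical pi_locmul_morph := PiMorph2 pi_locmul.

Lemma frac_eq (f g : fraction) :
  fnum f * fden g = fnum g * fden f -> f = g %[mod localization].
Proof.
move=> fg; apply/eqP/localization_eqP; exists 1; first exact: mul_closure1.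
by rewrite fg subrr mulr0.
Qed.

Lemma locaddA : associative locadd.
Proof.
move=> x y z; rewrite -[x]reprK -[y]reprK -[z]reprK !piE.
by apply: frac_eq => /=; ring.
Qed.

Lemma locaddC : commutative locadd.
Proof.
by move=> x y; rewrite -[x]reprK -[y]reprK !piE; apply: frac_eq => /=; ring.
Qed.

Lemma locadd0 : left_id loc0 locadd.
Proof. by move=> x; rewrite -[x]reprK !piE; apply: frac_eq => /=; ring. Qed.

Lemma locaddN : left_inverse loc0 locopp locadd.
Proof. by move=> x; rewrite -[x]reprK !piE; apply: frac_eq => /=; ring. Qed.

Lemma locmulA : associative locmul.
Proof.
move=> x y z; rewrite -[x]reprK -[y]reprK -[z]reprK !piE.
by apply: frac_eq => /=; ring.
Qed.

Lemma locmulC : commutative locmul.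
Proof.
by move=> x y; rewrite -[x]reprK -[y]reprK !piE; apply: frac_eq => /=; ring.
Qed.

Lemma locmul1 : left_id loc1 locmul.
Proof. by move=> x; rewrite -[x]reprK !piE; apply: frac_eq => /=; ring. Qed.

Lemma locmulDl : left_distributive locmul locadd.
Proof.
move=> x y z; rewrite -[x]reprK -[y]reprK -[z]reprK !piE.
by apply: frac_eq => /=; ring.
Qed.

HB.instance Definition _ := GRing.isZmodule.Build localization
  locaddA locaddC locadd0 locaddN.
HB.instance Definition _ := GRing.Zmodule_isComPzRing.Build localization
  locmulA locmulC locmul1 locmulDl.

Definition to_localization (x : A) : localization :=
  \pi_localization (frac x mul_closure1).

Lemma to_localization_zmod : zmod_morphism to_localization.
Proof.
move=> x y; rewrite /to_localization.
rewrite -[RHS]/(locadd _ (locopp _)) !piE.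
by apply: frac_eq => /=; ring.
Qed.

Lemma to_localization_monoid : monoid_morphism to_localization.
Proof.
split=> [|x y]; first by rewrite -[RHS]/loc1 !piE.
rewrite /to_localization -[RHS]/(locmul _ _) !piE.
by apply: frac_eq => /=; ring.
Qed.

HB.instance Definition _ :=
  GRing.isZmodMorphism.Build A localization to_localization to_localization_zmod.
HB.instance Definition _ :=
  GRing.isMonoidMorphism.Build A localization to_localization
    to_localization_monoid.

End Localization.

Lemma mul_closure_prime (A : comPzRingType) (P : ideal A) :
  prime_ideal P -> mul_closure (~` P) = ~` P.
Proof.
move=> [P1 PM]; apply/seteqP; split=> [x Sx|x Px M _ SM _]; last exact: SM.
by apply: Sx => // y z Py Pz yz; case: (PM _ _ yz).
Qed.

(* Only the values of [dval] at nonzero elements matter.                      *)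
Record discrete_valuation (F : comPzRingType) := DiscreteValuation {
  dval :> F -> int;
  dvalM : forall x y, x <> 0 -> y <> 0 -> dval (x * y) = dval x + dval y;
  dvalD : forall x y, x <> 0 -> y <> 0 -> x + y <> 0 ->
    Order.min (dval x) (dval y) <= dval (x + y);
  dval_surj : forall m : int, exists2 x, x <> 0 & dval x = m }.

Section Valuation.
Variables (F : comPzRingType) (v : discrete_valuation F).

Definition val_ge (m : int) (x : F) : Prop := x = 0 \/ m <= v x.

Definition complete_valuation : Prop :=
  forall u : nat -> F,
    (forall m : int, exists N, forall i j,
       (N <= i)%N -> (N <= j)%N -> val_ge m (u i - u j)) ->
    exists l, forall m : int, exists N, forall i,
       (N <= i)%N -> val_ge m (u i - l).

Lemma val_geD m x y : val_ge m x -> val_ge m y -> val_ge m (x + y).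
Proof.
have [->|/eqP x0] := eqVneq x 0; first by rewrite add0r.
have [->|/eqP y0] := eqVneq y 0; first by rewrite addr0.
have [->|/eqP xy0] := eqVneq (x + y) 0; first by left.
move=> [//|mx] [//|my]; right; apply: le_trans (dvalD v x0 y0 xy0).
by rewrite le_min mx.
Qed.

Lemma val_geM m p x y : val_ge m x -> val_ge p y -> val_ge (m + p) (x * y).
Proof.
have [->|/eqP x0] := eqVneq x 0; first by rewrite mul0r; left.
have [->|/eqP y0] := eqVneq y 0; first by rewrite mulr0; left.
by move=> [//|mx] [//|py]; right; rewrite dvalM // lerD.
Qed.

Lemma val_ge1 : val_ge 0 1.
Proof.
have [|/eqP n0] := eqVneq (1 : F) 0; first by left.
right; have := dvalM v n0 n0; rewrite mulr1 => v1.
by rewrite -[v 1](addrK (v 1)) -v1 subrr.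
Qed.

Lemma val_geN1 : val_ge 0 (- 1).
Proof.
have [|/eqP n0] := eqVneq (- 1 : F) 0; first by left.
right; have := dvalM v n0 n0; rewrite mulrNN mulr1 => v1.
case: val_ge1 => [e|]; first by case: n0; rewrite e oppr0.
by rewrite v1 -mulr2n pmulrn_lge0.
Qed.

Definition in_valring (x : F) : bool := `[< val_ge 0 x >].

Lemma in_valring_closed : subring_closed in_valring.
Proof.
split; first by apply/asboolP; apply: val_ge1.
- move=> x y /asboolP vx /asboolP vy; apply/asboolP; apply: val_geD => //.
  by rewrite -mulN1r -[0]add0r; apply: val_geM => //; apply: val_geN1.
- move=> x y /asboolP vx /asboolP vy; apply/asboolP.
  by rewrite -[0]add0r; apply: val_geM.
Qed.

Record valring := ValRing {
  valring_val :> F;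
  valringP : in_valring valring_val }.

HB.instance Definition _ := [isSub for valring_val].
HB.instance Definition _ := [Choice of valring by <:].
HB.instance Definition _ :=
  GRing.SubChoice_isSubComPzRing.Build F in_valring valring in_valring_closed.

Definition valmax (x : valring) : Prop := val_ge 1 (x : F).

Lemma valmax0 : valmax 0. Proof. by left. Qed.

Lemma valmaxD x y : valmax x -> valmax y -> valmax (x + y).
Proof. exact: val_geD. Qed.

Lemma valmaxM a x : valmax x -> valmax (a * x).
Proof.
by rewrite /valmax -[1]add0r; apply: val_geM; apply/asboolP; apply: valringP.
Qed.

Definition valmax_ideal : ideal valring := Ideal valmax0 valmaxD valmaxM.

Definition valuation_residue : comPzRingType := quotient_ring valmax_ideal.

End Valuation.

Definition cdvf (F : comPzRingType) : Prop :=
  is_field F /\ exists v : discrete_valuation F, complete_valuation v.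

(* The residue field with respect to the (unique) complete surjective         *)
(* discrete valuation; junk value F when F is not a cdvf.                     *)
Definition residue (F : comPzRingType) : comPzRingType :=
  match pselect (cdvf F) with
  | left FP => valuation_residue (projT1 (cid FP.2))
  | right _ => F
  end.

Fixpoint residue_field (i : nat) (F : comPzRingType) : comPzRingType :=
  if i is j.+1 then residue (residue_field j F) else F.

(* The number of successive residue fields, starting with F itself, which are *)
(* cdvf's; [None] stands for infinity. See [cdvdim0] and [cdvdimS] for the    *)
(* defining recursion.                                                        *)
Definition cdvdim (F : comPzRingType) : option nat :=
  match pselect (exists i, ~~ `[< cdvf (residue_field i F) >]) with
  | left FP => Some (ex_minn FP)
  | right _ => None
  end.

Definition cdvdim_ge (F : comPzRingType) (n : nat) : Prop :=
  if cdvdim F is Some d then (n <= d)%N else True.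

Lemma residue_fieldS i F :
  residue_field i.+1 F = residue_field i (residue F).
Proof. by elim: i => //= i <-. Qed.

Lemma cdvdim0 F : ~ cdvf F -> cdvdim F = Some 0%N.
Proof.
move=> nF; rewrite /cdvdim; case: pselect => [FP|[]]; last first.
  by exists 0%N; apply/asboolPn.
congr Some; case: ex_minnP => m _ /(_ 0%N); rewrite leqn0 => m0.
by apply/eqP/m0/asboolPn.
Qed.

Lemma cdvdimS F : cdvf F -> cdvdim F = omap succn (cdvdim (residue F)).
Proof.
move=> cF; rewrite /cdvdim.
case: pselect => [FP|nFP]; case: pselect => [RP|nRP] //=.
- congr Some; case: ex_minnP => -[/asboolPn//|m mP mmin].
  case: ex_minnP => p pP pmin; congr succn; apply/eqP.
  rewrite eqn_leq pmin -?residue_fieldS // andbT -ltnS mmin //.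
  by rewrite residue_fieldS.
- case: nRP; case: FP => -[/asboolPn//|m]; rewrite residue_fieldS.
  by exists m.
- by case: nFP; case: RP => m mP; exists m.+1; rewrite residue_fieldS.
Qed.

Record ring_chain (n : nat) := RingChain {
  chain_ring :> comPzRingType;
  chain_ideal : 'I_n.+1 -> ideal chain_ring }.

Definition regular_chain (n : nat) (A : ring_chain n) : Prop :=
  [/\ regular_local A /\ krull_dim A n,
      forall i, prime_ideal (chain_ideal A i),
      forall i j : 'I_n.+1, (i < j)%N ->
        chain_ideal A i `<` chain_ideal A j &
      forall i, regular_local (quotient_ring (chain_ideal A i))].

Definition chain_comp (n : nat) (A : ring_chain n) : ring_chain n :=
  RingChain (fun i =>
    ideal_ext (@to_completion A (chain_ideal A ord_max)) (chain_ideal A i)).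

Definition chain_loc (n : nat) (A : ring_chain n.+1) : ring_chain n :=
  let p i := chain_ideal A (widen_ord (leqnSn n.+1) i) in
  RingChain (fun i => ideal_ext (@to_localization A (~` p ord_max)) (p i)).

Fixpoint HL (n : nat) : ring_chain n -> ring_chain 0 :=
  if n is m.+1 then fun A => HL (chain_loc (chain_comp A)) else id.

(* A regular chain (F, 0) of length 0 is identified with the field F.         *)
Definition is_field_chain (F : ring_chain 0) : Prop :=
  is_field F /\ chain_ideal F ord0 = [set 0] :> set F.

(* Main.v *)
Require Import Defs.
From HB Require Import structures.
From mathcomp Require Import all_boot all_order all_algebra.
From mathcomp Require Import all_classical.
From mathcomp Require Import ring zify.

(* No dimension theory is needed.  Let m be the maximal ideal of A.  The      *)
(* primes below p_i show that the regular ring A/p_i has dimension at most    *)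
(* n - i, so m is generated by p_i and n - i further elements.  Going down,   *)
(* suppose p_{j+1} = p_j + (x_j) for all j >= i.  These x_j form a regular    *)
(* sequence modulo p_i, hence x_j is not in p_j + m^2, and n - i of the       *)
(* n - i + 1 generators of m modulo p_{i-1} can be exchanged against them;    *)
(* the last one can be taken in p_i, and by Nakayama it generates p_i modulo  *)
(* p_{i-1}.  The same argument with n generators of m gives p_0 = 0.          *)
(*                                                                            *)
(* From there on only "p_0 = 0, p_{j+1} = p_j + (x_j) prime, A/p_n a field"   *)
(* is used.  The colon identity (p_i + m^{k+1} : x_i) = p_i + m^k makes the   *)
(* m-adic filtration of A/p_i multiplicative, so the completion is again of   *)
(* this form and the extension of p_i is its closure.  Completion and         *)
(* localisation thus commute with passing to A/p_1: HL(A) is the fraction     *)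
(* field of a complete discrete valuation ring with residue ring HL(A/p_1),   *)
(* and one concludes by induction on n.                                       *)

Set Implicit Arguments.
Unset Strict Implicit.
Unset Printing Implicit Defensive.

Import Order.TTheory GRing.Theory Num.Theory.
Local Open Scope classical_set_scope.
Local Open Scope ring_scope.
Local Open Scope quotient_scope.

(** * Ideals *)

(** Everything rests on one fact: the residue field of [HL A] is [HL] of the quotient chain on
    [A/p_1]. Induction on [n] then gives the bound on the dimension, and the last residue field is
    an iterated quotient of [A], namely [A/p_n] ([HL_cdvdim]).

    Regularity enters through parameters ([regular_chain_param]): [p_0] is zero and [p_{i+1}] is
    [p_i] plus one element [x_i]. This is a count of generators of the maximal ideal
    ([span_of_regular_quotient]). The powers of [p_n] then behave as in a polynomial ring: division
    by [x_i] modulo [p_i] lowers the order by at most one ([colon_firstP]), and the graded ring of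
    each [A/p_i] is a domain ([filtration_prime_graded]). By the first property Cauchy sequences can
    be divided by [x_i] term by term, so the extended ideals are closed ([ideal_ext_completion]); by
    the second they are prime. Hence parameters survive completion ([completion_param_chain]), and
    they survive localisation ([localization_param_chain]).

    The surjection from [A] to [A/p_1] matches [p_{i+1}] with the i-th ideal of the quotient, and
    the match survives both operations ([completion_corr], [localization_corr]). Once the chain on
    [A] has length one and the quotient has length zero, completion gives a complete discrete
    valuation ring with uniformiser [x_0]; its fraction field has the quotient as residue field
    ([completion_fraction_residue], [HL_residue]).

    The definition of [residue] chooses a complete valuation. The choice is immaterial: principal
    units of a complete discrete valuation have l-power roots of all orders for some [l > 1], so
    every discrete valuation vanishes on them, which forces equal valuation rings ([val_ge_uniq]).
    Hence residue fields respect ring isomorphisms ([cdvf_iso]). *)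

Section Ideals.
Variable A : comPzRingType.
Implicit Types (I J K M P : ideal A) (S : set A) (x y z : A).

Lemma ideal_mulr I x a : I x -> I (x * a).
Proof. by rewrite mulrC; apply: idealM. Qed.

Lemma ideal_sub I x y : I (x - y) -> I y -> I x.
Proof. by move=> xy /(idealD xy); rewrite subrK. Qed.

Lemma ideal_gen_sub S I : S `<=` I -> ideal_gen S `<=` I.
Proof. by move=> SI x; apply. Qed.

Lemma sub_ideal_gen S : S `<=` ideal_gen S.
Proof. by move=> x Sx I; apply. Qed.

Definition zero_ideal : ideal A.
Proof.
exists [set 0] => // [x y -> ->|a x ->]; first exact: addr0.
exact: mulr0.
Defined.

Definition ideal_add I J : ideal A.
Proof.
exists [set x | exists2 y, I y & J (x - y)].
- by exists 0; rewrite ?subrr; apply: ideal0.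
- move=> x y [x' Ix Jx] [y' Iy Jy]; exists (x' + y'); first exact: idealD.
  by rewrite opprD addrACA; apply: idealD.
- move=> a x [x' Ix Jx]; exists (a * x'); first exact: idealM.
  by rewrite -mulrBr; apply: idealM.
Defined.

Lemma ideal_addl I J x : I x -> ideal_add I J x.
Proof. by exists x; rewrite // subrr; apply: ideal0. Qed.

Lemma ideal_addr I J x : J x -> ideal_add I J x.
Proof. by exists 0; rewrite ?subr0 //; apply: ideal0. Qed.

Lemma ideal_addS I J I' J' :
  I `<=` I' -> J `<=` J' -> ideal_add I J `<=` ideal_add I' J'.
Proof. by move=> II' JJ' x [y Iy Jy]; exists y; [apply: II' | apply: JJ']. Qed.

Definition adjoin I x : ideal A.
Proof.
exists [set y | exists a, I (y - a * x)].
- by exists 0; rewrite mul0r subrr; apply: ideal0.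
- move=> y z [a Iy] [b Iz]; exists (a + b).
  by rewrite mulrDl opprD addrACA; apply: idealD.
- move=> c y [a Iy]; exists (c * a).
  by rewrite -mulrA -mulrBr; apply: idealM.
Defined.

Lemma adjoinl I x y : I y -> adjoin I x y.
Proof. by exists 0; rewrite mul0r subr0. Qed.

Lemma adjoinr I x : adjoin I x x.
Proof. by exists 1; rewrite mul1r subrr; apply: ideal0. Qed.

Lemma adjoin_sub I J x : I `<=` J -> J x -> adjoin I x `<=` J.
Proof. by move=> IJ Jx y [a /IJ Iy]; apply: ideal_sub Iy _; apply: idealM. Qed.

Definition colon I y : ideal A.
Proof.
exists (fun x => I (x * y)) => [|x z Ix Iz|a x Ix].
- by rewrite mul0r; apply: ideal0.
- by rewrite mulrDl; apply: idealD.
- by rewrite -mulrA; apply: idealM.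
Defined.

Lemma ideal_pow0 I x : ideal_pow I 0 x.
Proof. exact: sub_ideal_gen. Qed.

Lemma ideal_powM I k x y :
  I x -> ideal_pow I k y -> ideal_pow I k.+1 (x * y).
Proof. by move=> Ix Iy; apply: sub_ideal_gen; exists x => //; exists y. Qed.

Lemma ideal_powS_sub I k J :
  (forall x y, I x -> ideal_pow I k y -> J (x * y)) ->
  ideal_pow I k.+1 `<=` J.
Proof.
by move=> IJ; apply: ideal_gen_sub => _ [x Ix [y Iy <-]]; apply: IJ.
Qed.

Lemma ideal_powS I k : ideal_pow I k.+1 `<=` ideal_pow I k.
Proof. by apply: ideal_powS_sub => x y _; apply: idealM. Qed.

Lemma ideal_pow_le I k l : (k <= l)%N -> ideal_pow I l `<=` ideal_pow I k.
Proof.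
elim: l => [|l IHl]; first by rewrite leqn0 => /eqP ->.
by rewrite leq_eqVlt => /predU1P[-> //|/IHl lk] x /ideal_powS /lk.
Qed.

Lemma ideal_pow_mono I J k : I `<=` J -> ideal_pow I k `<=` ideal_pow J k.
Proof.
move=> IJ; elim: k => [|k IHk] x; first by move=> _; apply: ideal_pow0.
by apply: ideal_powS_sub => y z /IJ Jy /IHk Jz; apply: ideal_powM.
Qed.

Lemma ideal_powD I k l x y :
  ideal_pow I k x -> ideal_pow I l y -> ideal_pow I (k + l) (x * y).
Proof.
move=> + Iy; elim: k x => [|k IHk] x; first by move=> _; apply: idealM.
apply: (@ideal_powS_sub _ _ (colon (ideal_pow I (k.+1 + l)) y)) => u v Iu.
move=> /IHk Iv; rewrite /colon /= -mulrA; exact: ideal_powM.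
Qed.

Lemma ideal_pow1 I : ideal_pow I 1 `<=` I.
Proof. by apply: ideal_powS_sub => x y Ix _; apply: ideal_mulr. Qed.

Lemma ideal_powS1 I k : ideal_pow I k.+1 `<=` I.
Proof. by move=> x /(@ideal_pow_le I 1 k.+1 isT) /ideal_pow1. Qed.

(** Split every factor of a product in [J] into an element of [I] and a multiple of [x]: the product
    of the [I]-parts lies in the power of [I], and the rest is [x] times an element of the previous
    power of [J]. *)
Lemma ideal_pow_adjoin I J x k : J `<=` adjoin I x -> I `<=` J ->
  ideal_pow J k.+1 `<=` 
    [set y | exists2 b, ideal_pow J k b & ideal_pow I k.+1 (y - x * b)].
Proof.
move=> JIx IJ.
elim: k => [|k IHk].
  move=> y /ideal_pow1 /JIx [a Ia]; exists a; first exact: ideal_pow0.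
  rewrite -[_ - _]mulr1 mulrC (mulrC x); apply: sub_ideal_gen.
  by exists (y - a * x) => //; exists 1; [apply: ideal_pow0 | rewrite mulrC].
pose L : ideal A := @Ideal _ [set y | exists2 b, ideal_pow J k.+1 b &
    ideal_pow I k.+2 (y - x * b)]
  ltac:(by exists 0; [exact: ideal0 | rewrite mulr0 subrr; exact: ideal0])
  ltac:(by move=> u v [b Jb Iu] [c Jc Iv]; exists (b + c);
    [apply: idealD | rewrite mulrDr opprD addrACA; apply: idealD])
  ltac:(by move=> c u [b Jb Iu]; exists (c * b);
    [apply: idealM | rewrite mulrCA -mulrBr; apply: idealM]).
apply: (@ideal_powS_sub _ _ L) => y z Jy Jz.
have [a Ia] := JIx _ Jy; have [b Jb Iz] := IHk _ Jz.
exists (a * z + (y - a * x) * b).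
  apply: idealD; first exact: idealM.
  by apply: ideal_powM => //; apply: IJ.
have -> : y * z - x * (a * z + (y - a * x) * b) = (y - a * x) * (z - x * b).
  by ring.
exact: ideal_powM.
Qed.

End Ideals.

(** * Regular sequences of primes *)

Section RegularSequence.
Variables (A : comPzRingType) (n : nat) (p : nat -> ideal A) (x : nat -> A).
Hypothesis pS : forall i, (i < n)%N -> p i.+1 = adjoin (p i) (x i) :> set A.
Hypothesis x_reg : forall i a, (i < n)%N -> p i (x i * a) -> p i a.

(** The [p j]-adic filtration of the quotient by [p i], pulled back to [A] so that all computations
    stay in one ring. *)
Let q i j k := ideal_add (p i) (ideal_pow (p j) k).

Lemma chain_le i j : (i <= j <= n)%N -> p i `<=` p j.
Proof.
elim: j => [|j IHj]; first by rewrite leqn0 => /andP[/eqP-> _] a.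
case/andP; rewrite leq_eqVlt => /orP[/eqP->|ij jn] a pa //.
by rewrite pS //; apply: adjoinl; apply: IHj pa; rewrite -ltnS ij ltnW.
Qed.

Lemma chain_mem i j : (i < j <= n)%N -> p j (x i).
Proof.
move=> /andP[ij jn]; apply: (@chain_le i.+1); first by rewrite ij.
by rewrite pS ?(leq_trans ij) //; apply: adjoinr.
Qed.

Let q0 i j a : q i j 0 a.
Proof. by apply: ideal_addr; apply: ideal_pow0. Qed.

Let qM i j k a b : p j a -> q i j k b -> q i j k.+1 (a * b).
Proof.
move=> pa [c pc pb]; exists (a * c); first exact: idealM.
by rewrite -mulrBr; apply: ideal_powM.
Qed.

Let q_succ i j k a : (i < n)%N -> q i.+1 j k a -> exists c,
  q i j k (a - x i * c).
Proof.
move=> lt_in [b]; rewrite pS // => -[c pb] pab; exists c;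
  exists (b - c * x i) => //.
by have -> : a - x i * c - (b - c * x i) = a - b by ring.
Qed.

Let q_last i j k a : (i <= j < n)%N -> q i j.+1 k.+1 a ->
  exists2 b, ideal_pow (p j.+1) k b & q i j k.+1 (a - x j * b).
Proof.
move=> /andP[lij ljn] [c pc].
have pjS : p j.+1 `<=` adjoin (p j) (x j) by rewrite pS.
have pj : p j `<=` p j.+1 by apply: chain_le; rewrite leqnSn.
move=> /(ideal_pow_adjoin pjS pj)[b pb pe]; exists b => //; exists c => //.
by rewrite addrAC.
Qed.

Let qS i i' j j' k a : (i <= i' <= n)%N -> (j <= j' <= n)%N ->
  q i j k a -> q i' j' k a.
Proof.
by move=> ii' jj'; apply: ideal_addS; [|apply: ideal_pow_mono]; apply: chain_le.
Qed.

(* These two statements are proved by a mutual induction, in the order        *)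
(* colon_first j, colon_next j, colon_first j.+1.                             *)
Definition colon_first j := forall i k a, (i < j)%N ->
  q i j k.+1 (x i * a) -> q i j k a.

Definition colon_next j := forall i k a, (i <= j)%N ->
  q i j k (x j * a) -> q i j k a.

(** Descending induction on [i] from [i = j], where the power is absorbed by [p j]. Below that, [a]
    is some [x i * c] up to the filtration; [colon_first] cancels [x i] from [x i * (x j * c)], and
    the degree lost is regained by induction on [k]. *)
Let colon_nextP j : (j < n)%N -> colon_first j -> colon_next j.
Proof.
move=> jn colF i k a lij; rewrite -(subKn lij).
elim: (j - i)%N {lij} k a => {i} [|d IHd] k a.
  rewrite subn0; case: k => [|k]; first by move=> _; apply: q0.
  move=> [b pb /ideal_powS1 pxb]; apply: ideal_addl.
  by apply: x_reg => //; apply: ideal_sub pb.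
(* For [j <= d] both truncated differences are 0 and the claim is the induction hypothesis
   itself. *)
have [jd|dj] := leqP j d.
  move: (IHd k a); have [-> ->] : (j - d.+1 = 0)%N /\ (j - d = 0)%N by lia.
  by [].
set i := (j - d.+1)%N; have eid : (j - d = i.+1)%N by rewrite /i; lia.
rewrite eid in IHd.
have [lij ltin] : (i < j)%N /\ (i < n)%N by rewrite /i; lia.
elim: k a => [|k IHk] a; first by move=> _; apply: q0.
move=> qxa; have /q_succ[//|c qac] : q i.+1 j k.+1 a.
  by apply: IHd; apply: qS qxa; rewrite ?leqnn ?leqnSn ?(ltnW jn) ?ltin.
have qc : q i j k c.
  apply: IHk; apply: colF => //.
  have -> : x i * (x j * c) = x j * a - x j * (a - x i * c) by ring.
  by apply: idealB => //; apply: idealM.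
apply: ideal_sub qac _; apply: qM => //; apply: chain_mem.
by rewrite lij ltnW.
Qed.

(** By [q_last] the new power is the old one plus multiples of [x j]. For [i = j] cancel [x j]
    modulo [p j]. For [i < j] the term [x j * b] is small modulo [p i.+1], so [colon_next] makes [b]
    a multiple [x i * c]; then [a - x j * c] falls under the statement for [j], and [c] under the
    induction on [k]. *)
Lemma colon_firstP j : (j <= n)%N -> colon_first j.
Proof.
elim: j => [|j IHj] // jn i k a; rewrite ltnS leq_eqVlt => /predU1P[->|lij].
  move=> /q_last[|b pb [c pc /ideal_powS1 pxab]]; first by rewrite leqnn.
  apply: (@ideal_sub _ _ _ b); last exact: ideal_addr.
  apply: ideal_addl; apply: x_reg => //.
  by rewrite mulrBr; apply: ideal_sub pc.
have colF : colon_first j by apply: IHj; apply: ltnW.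
have ltin : (i < n)%N by lia.
elim: k a => [|k IHk] a; first by move=> _; apply: q0.
move=> /q_last[|b pb qe]; first by rewrite (ltnW lij).
have qb : q i.+1 j k.+2 (x j * b).
  rewrite -[x j * b](subKr (x i * a)); apply: idealB.
    by apply: ideal_addl; rewrite mulrC; apply: idealM; apply: chain_mem;
      rewrite leqnn.
  by apply: qS qe; rewrite ?leqnn ?leqnSn ?ltin ?(ltnW jn).
have /q_succ[//|c qbc] := colon_nextP jn colF lij qb.
have qac : q i j k.+1 (a - x j * c).
  apply: colF => //.
  have -> : x i * (a - x j * c) = (x i * a - x j * b) + x j * (b - x i * c).
    by ring.
  by apply: idealD => //; apply: idealM.
have le1 : (i <= i <= n)%N by rewrite leqnn ltnW.
have le2 : (j <= j.+1 <= n)%N by rewrite leqnSn.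
have qc : q i j.+1 k c.
  apply: IHk; rewrite -[x i * c](subKr b); apply: idealB.
    exact: ideal_addr.
  by apply: (qS le1 le2); apply: ideal_addS qbc => //; apply: ideal_powS.
apply: (@ideal_sub _ _ _ (x j * c)); first exact: qS le1 le2 qac.
by apply: qM => //; apply: chain_mem; rewrite leqnn.
Qed.

(** Cancelling [x i] would put 1 in [p i] plus [p n], which is [p n]. *)
Lemma notin_square i : (i < n)%N -> ~ p n 1 -> ~ q i n 2 (x i).
Proof.
move=> ltin pn1; rewrite -[x i]mulr1 => /colon_firstP[//|//|b pb /ideal_pow1].
by move=> p1b; apply: pn1; apply: ideal_sub p1b _; apply: chain_le pb;
  rewrite ltnW /=.
Qed.

Hypothesis pn_prime : prime_ideal (p n).

(** In the graded ring of [A] modulo [p i], the class of [x i] is a nonzerodivisor of degree one by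
    [colon_firstP], and dividing by it gives the graded ring for [i.+1], a domain by descending
    induction. A degree argument then makes the graded ring for [i] a domain. *)
Lemma filtration_prime_graded i k l a b : (i <= n)%N ->
  q i n k a -> q i n l b -> q i n (k + l).+1 (a * b) ->
  q i n k.+1 a \/ q i n l.+1 b.
Proof.
move=> lin; rewrite -(subKn lin).
elim: (n - i)%N {lin} k l a b => {i} [|d IHd] k l a b.
  rewrite subn0 => _ _ [c pc /ideal_powS1 pab].
  have [|pa|pb] := pn_prime.2 a b; first exact: ideal_sub pc.
    by left; apply: ideal_addl.
  by right; apply: ideal_addl.
have [jd|dj] := leqP n d.
  move: (IHd k l a b); have [-> ->] : (n - d.+1 = 0)%N /\ (n - d = 0)%N by lia.
  by [].
set i := (n - d.+1)%N; have eid : (n - d = i.+1)%N by rewrite /i; lia.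
rewrite eid in IHd.
have ltin : (i < n)%N by rewrite /i; lia.
(* If the leading form of [a'] is a multiple of that of [x i], the cofactor [c] has degree one less;
   [IH] is the claim for [c] and [b']. *)
have red k' l' a' b' : (forall c, (0 < k')%N -> q i n k'.-1 c ->
  q i n (k' + l') (c * b') ->
   q i n k' c \/ q i n l'.+1 b') -> 
   q i n k' a' -> q i n l' b' -> q i n (k' + l').+1 (a' * b') ->
   q i.+1 n k'.+1 a' -> q i n k'.+1 a' \/ q i n l'.+1 b'.
  move=> IH qa qb qab /q_succ[//|c qac].
  case: k' IH qa qab qac => [|k'] IH qa qab qac.
    left; apply: ideal_sub qac _; apply: ideal_addr; rewrite -[x i * c]mulr1.
    by apply: ideal_powM; [apply: ideal_mulr; apply: chain_mem;
      lia | apply: ideal_pow0].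
  have qc : q i n k' c.
    apply: colon_firstP => //; rewrite -[x i * c](subKr a');
      apply: idealB => //.
    by apply: ideal_addS qac => //; apply: ideal_powS.
  case: (IH c) => // [|qc'|]; last by right.
    apply: colon_firstP => //.
    have -> : x i * (c * b') = a' * b' - (a' - x i * c) * b' by ring.
    apply: idealB; first by rewrite addSn in qab.
    case: qac qb => [u pu pau] [v pv pbv].
    exists (u * b' + (a' - x i * c - u) * v).
      by apply: idealD; [apply: ideal_mulr | apply: idealM].
    have -> : (a' - x i * c) * b' - (u * b' + (a' - x i * c - u) * v)
      = (a' - x i * c - u) * (b' - v) by ring.
    rewrite -[(k'.+1 + l').+1]/(k'.+2 + l')%N.
    exact: ideal_powD.
  left; apply: ideal_sub qac _; apply: qM => //; apply: chain_mem; lia.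
(* Induction on the total degree, which [red] lowers; either factor may be the one divisible by
   [x i], whence the swaps. *)
elim: {k l}(k + l)%N {-2}k {-2}l (leqnn (k + l)%N) a b =>
  [|s IHs] k l kls a b qa qb qab;
  (have := IHd k l a b; case; [by apply: qS qa; lia | by apply: qS qb;
    lia | by apply: qS qab; lia| |]).
- by apply: red qa qb qab => c k0; exfalso; lia.
- rewrite or_comm; apply: red qb qa _; first by move=> c l0; exfalso; lia.
  by rewrite mulrC addnC.
- apply: red qa (qb) qab => c k0 qc; case: k k0 kls qc => // k _ kls qc qcb.
  by apply: IHs => //; lia.
- rewrite or_comm; apply: red qb (qa) _; last by rewrite mulrC addnC.
  move=> c l0 qc; case: l l0 kls qc {qab} => // l _ kls qc qcb.
  rewrite or_comm; apply: IHs => //; first by lia.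
  by rewrite mulrC addnC.
Qed.

Lemma filtration_prime i k l a b : (i <= n)%N ->
  q i n (k + l) (a * b) -> q i n k a \/ q i n l b.
Proof.
move=> lin qab.
(* Reduction to elements of exact order, to which the graded statement applies. *)
have ord m c : q i n m c \/ exists2 m',
  (m' < m)%N & q i n m' c /\ ~ q i n m'.+1 c.
  elim: m => [|m [qc|[m' m'm qc]]]; first by left; apply: q0.
    have [qc'|nqc] := pselect (q i n m.+1 c); first by left.
    by right; exists m.
  by right; exists m' => //; apply: ltnW.
have [|[k' k'k [qa nqa]]] := ord k a; first by left.
have [|[l' l'l [qb nqb]]] := ord l b; first by right.
case: (@filtration_prime_graded i k' l' a b) => //.
by apply: ideal_addS qab => //; apply: ideal_pow_le; lia.
Qed.

End RegularSequence.

(** * Nakayama and exchange *)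

Section Span.
Variable A : comPzRingType.
Implicit Types (I J K M N P : ideal A) (x y z : A) (s t : seq A).

Definition ideal_span K s : ideal A := foldr (fun a I => adjoin I a) K s.

Lemma ideal_span_base K s : K `<=` ideal_span K s.
Proof. by elim: s => [|a s IHs] x // /IHs; apply: adjoinl. Qed.

Lemma ideal_span_mem K s x : x \in s -> ideal_span K s x.
Proof.
elim: s => // a s IHs; rewrite inE => /predU1P[->|/IHs]; first exact: adjoinr.
exact: adjoinl.
Qed.

Lemma ideal_span_sub K s I : K `<=` I -> (forall x, x \in s -> I x) ->
  ideal_span K s `<=` I.
Proof.
move=> KI; elim: s => // a s IHs sI; apply: adjoin_sub; last first.
  by apply: sI; rewrite mem_head.
by apply: IHs => x xs; apply: sI; rewrite inE xs orbT.
Qed.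

Lemma ideal_span_gen s : ideal_span (zero_ideal A)
  s = ideal_gen [set` s] :> set A.
Proof.
apply/seteqP; split; first apply: ideal_span_sub.
- by move=> _ ->; apply: ideal0.
- by move=> x xs; apply: sub_ideal_gen.
- by apply: ideal_gen_sub => x; apply: ideal_span_mem.
Qed.

Lemma ideal_span_split K s x :
  ideal_span K s x -> exists2 y, ideal_span (zero_ideal A) s y & K (x - y).
Proof.
elim: s x => [|a s IHs] x /=; first by exists 0; rewrite ?subr0.
move=> [b /IHs[y sy Ky]]; exists (y + b * a); first by exists b; rewrite addrK.
by have -> : x - (y + b * a) = x - b * a - y by ring.
Qed.

Definition ideal_mul I J : ideal A := ideal_gen [set a * b | a in I & b in J].

Lemma ideal_mulM I J x y : I x -> J y -> ideal_mul I J (x * y).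
Proof. by move=> Ix Jy; apply: sub_ideal_gen; exists x => //; exists y. Qed.

Section Local.
Variable M : ideal A.
Hypothesis M1 : ~ M 1.
Hypothesis M_unit : forall a, ~ M a -> exists b, b * a = 1.

Lemma exchange K s z : (forall a, a \in s -> M a) -> ideal_span K s z ->
  ideal_add K (ideal_pow M 2) z \/
  exists t, [/\ (size t).+1 = size s, {subset t <= s} &
    ideal_span K s `<=` ideal_span (adjoin K z) t].
Proof.
elim: s z => [|a s IHs] z sM; first by left; apply: ideal_addl.
move=> [b sz].
have Ma : M a by apply: sM; rewrite mem_head.
have {}sM c : c \in s -> M c by move=> cs; apply: sM; rewrite inE cs orbT.
have [Mb|/M_unit[c cb]] := pselect (M b); last first.
  right; exists s.
  have sub : ideal_span K s `<=` ideal_span (adjoin K z) s.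
    by apply: ideal_span_sub; [move=> u Ku;
      apply/ideal_span_base/adjoinl | apply: ideal_span_mem].
  split=> //; first by move=> u us; rewrite inE us orbT.
  apply: adjoin_sub => //.
  rewrite -[a]mul1r -cb.
  have -> : c * b * a = c * z - c * (z - b * a) by ring.
  apply: idealB; apply: idealM; last exact: sub.
  exact/ideal_span_base/adjoinr.
have M2 : ideal_pow M 2 (b * a).
  by apply: ideal_powM => //; rewrite -[a]mulr1; apply: ideal_powM => //;
    apply: ideal_pow0.
case: (IHs _ sM sz) => [qz|[t [st ts sub]]].
  by left; apply: ideal_sub qz _; apply: ideal_addr.
right; exists (a :: t); split; first by rewrite /= st.
  by move=> u; rewrite !inE => /predU1P[->|/ts ->]; rewrite ?eqxx ?orbT.
apply: adjoin_sub; last exact: adjoinr.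
move=> u /sub; apply: ideal_span_sub => [v|v vt]; last first.
  by apply: adjoinl; apply: ideal_span_mem.
apply: adjoin_sub => [w Kw|]; first exact/adjoinl/ideal_span_base/adjoinl.
apply: idealB; first exact/adjoinl/ideal_span_base/adjoinr.
exact/idealM/adjoinr.
Qed.

(** Generators are discarded one at a time: modulo [N] and the remaining ones, [a] equals [b * a]
    with [b] in [M], and [1 - b] is invertible. *)
Lemma nakayama N P s : P = ideal_gen [set` s] :> set A ->
  P `<=` ideal_add N (ideal_mul M P) -> P `<=` N.
Proof.
move=> Ps PN.
have: P `<=` ideal_span N s.
  by rewrite Ps; apply: ideal_gen_sub => x; apply: ideal_span_mem.
have {Ps} : forall x, x \in s -> P x.
  by move=> x xs; rewrite Ps; apply: sub_ideal_gen.
elim: s => [|a s IHs] // sP PNs; apply: IHs.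
  by move=> x xs; apply: sP; rewrite inE xs orbT.
suff sa : ideal_span N s a by move=> x /PNs; apply: adjoin_sub sa _.
have MP : ideal_mul M P `<=` [set x | exists2 b,
  M b & ideal_span N s (x - b * a)].
  pose L : ideal A := @Ideal _ [set x | exists2 b,
    M b & ideal_span N s (x - b * a)]
    ltac:(by exists 0; [exact: ideal0 | rewrite mul0r subrr; exact: ideal0])
    ltac:(by move=> u v [b Mb su] [c Mc sv]; exists (b + c);
       [exact: idealD | rewrite mulrDl opprD addrACA; exact: idealD])
    ltac:(by move=> c u [b Mb su]; exists (c * b);
       [exact: idealM | rewrite -mulrA -mulrBr; exact: idealM]).
  apply: (@ideal_gen_sub _ _ L) => _ [u Mu [v /PNs[b sv] <-]].
  exists (u * b); first exact: ideal_mulr.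
  by rewrite -mulrA -mulrBr; apply: idealM.
have [c Nc /MP[b Mb sac]] := PN a (sP _ (mem_head _ _)).
have [Mb1|/M_unit[d d1]] := pselect (M (1 - b)).
  by case: M1; rewrite -(subrK b 1); apply: idealD.
rewrite -[a]mul1r -d1.
have -> : d * (1 - b) * a = d * ((a - c - b * a) + c) by ring.
by apply: idealM; apply: idealD => //; apply: ideal_span_base.
Qed.

End Local.
End Span.

(** * Counting generators along a chain of parameters *)

Section LiftedParameters.
Variables (A : comPzRingType) (n : nat) (p : nat -> ideal A) (x : nat -> A).
Hypothesis pS : forall i, (i < n)%N -> p i.+1 = adjoin (p i) (x i) :> set A.
Hypothesis x_reg : forall i a, (i < n)%N -> p i (x i * a) -> p i a.
Hypothesis pn1 : ~ p n 1.
Hypothesis pn_unit : forall a, ~ p n a -> exists b, b * a = 1.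
Variables (K : ideal A) (s : seq A).
Hypothesis Kp : K `<=` p 0%N.
Hypothesis p_span : p n = ideal_span K s :> set A.
Hypothesis p0_fg : exists g : seq A, p 0%N = ideal_gen [set` g] :> set A.

Let y i : ideal A := iteri i (fun j I => adjoin I (x j)) K.

Let y_sub i : (i <= n)%N -> y i `<=` p i.
Proof.
elim: i => [|i IHi] lin //=; rewrite pS //.
by apply: adjoin_sub (adjoinr _ _) => a /(IHi (ltnW lin)); apply: adjoinl.
Qed.

Let p_split i : (i <= n)%N -> p i `<=` ideal_add (p 0%N) (y i).
Proof.
elim: i => [|i IHi] lin; first by move=> a; apply: ideal_addl.
rewrite pS //; apply: adjoin_sub => [a /(IHi (ltnW lin))|].
  by apply: ideal_addS => // b; apply: adjoinl.
exact/ideal_addr/adjoinr.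
Qed.

(* Regularity of x modulo p 0 makes p 0 meet the ideal generated by x only in *)
(* the obvious elements: this is the vanishing of a Tor_1.                    *)
Let y_cap i : (i <= n)%N -> forall z, y i z -> p 0%N z ->
  ideal_add K (ideal_mul (p n) (p 0%N)) z.
Proof.
elim: i => [|i IHi] lin z; first by move=> Kz _; apply: ideal_addl.
move=> [b yz] pz.
have : p i b.
  apply: x_reg => //.
  rewrite mulrC -[b * x i](subKr z); apply: idealB.
    by apply: (chain_le pS) pz; rewrite //= ltnW.
  exact: y_sub (ltnW lin) _ yz.
move=> /(p_split (ltnW lin))[c pc ye].
have -> : z = (z - b * x i + (b - c) * x i) + x i * c by ring.
have pnxc : ideal_mul (p n) (p 0%N) (x i * c).
  by apply: ideal_mulM => //; apply: (chain_mem pS); rewrite lin leqnn.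
apply: idealD; last exact: ideal_addr.
apply: IHi; first exact: ltnW.
  by apply: idealD => //; apply: ideal_mulr.
have -> : z - b * x i + (b - c) * x i = z - x i * c by ring.
by apply: idealB => //; apply: idealM.
Qed.

(** Each [x i] replaces one generator of [p n], because [notin_square] keeps it out of [y i] plus
    the square of [p n]. *)
Let y_exchange i : (i <= n)%N ->
  exists2 t, (size t + i)%N = size s & p n = ideal_span (y i) t :> set A.
Proof.
elim: i => [|i IHi] lin; first by exists s; rewrite ?addn0.
have [t st pt] := IHi (ltnW lin).
have tp a : a \in t -> p n a by rewrite pt; apply: ideal_span_mem.
have : ideal_span (y i) t (x i).
  by rewrite -pt; apply: (chain_mem pS); rewrite lin leqnn.
move=> /(exchange pn_unit tp)[xi|[t' [st' tt' sub]]].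
  case: (notin_square pS x_reg lin pn1); apply: ideal_addS xi => //.
  exact: y_sub (ltnW lin).
exists t'; first by rewrite addnS -addSn st'.
apply/seteqP; split; first by rewrite pt.
apply: ideal_span_sub => [a|a /tt' /tp //].
by move/(y_sub lin); apply: (chain_le pS); rewrite //= lin leqnn.
Qed.

(** The generators left after exchanging all [x i] can be moved into [p 0] modulo [y n]. By [y_cap]
    they then generate [p 0] over [K] up to [p n] times [p 0], and Nakayama removes this error. *)
Lemma span_of_regular_quotient :
  exists2 t, (size t + n)%N = size s & p 0%N = ideal_span K t :> set A.
Proof.
have [t st pt] := y_exchange (leqnn n).
have p0n : p 0%N `<=` p n by apply: (chain_le pS); rewrite //= leqnn.
have [t' st' [t'p yt']] : exists2 t', size t' = size t &
    (forall a, a \in t' -> p 0%N a) /\ ideal_span (y n) t `<=` ideal_span (y n)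
      t'.
  have: forall a, a \in t -> p n a by move=> a at'; rewrite pt;
    apply: ideal_span_mem.
  elim: (t) => [|a u IHu] up; first by exists [::] => //; split.
  have [|v uv [vp yv]] := IHu; first by move=> b bu; apply: up;
    rewrite inE bu orbT.
  have [b pb yb] : ideal_add (p 0%N) (y n) a.
    by apply: p_split => //; apply: up; rewrite mem_head.
  exists (b :: v); first by rewrite /= uv.
  split; first by move=> c; rewrite inE => /predU1P[->|/vp].
  apply: adjoin_sub => [c /yv|]; first exact: adjoinl.
  apply: ideal_sub (adjoinr _ _); exact/adjoinl/ideal_span_base.
exists t'; first by rewrite st' st.
have Ktp : ideal_span K t' `<=` p 0%N by apply: ideal_span_sub.
apply/seteqP; split=> //.
have [g pg] := p0_fg; apply: (nakayama pn1 pn_unit pg) => z pz.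
have : ideal_span (y n) t' z by apply: yt'; rewrite -pt; apply: p0n.
move=> /ideal_span_split[w tw yzw].
have tw' : ideal_span K t' w.
  apply: ideal_span_sub tw => [_ ->|]; first exact: ideal0.
  exact: ideal_span_mem.
have := y_cap (leqnn n) yzw (idealB pz (Ktp _ tw')).
move=> [c Kc pzc]; exists (c + w).
  by apply: idealD => //; apply: ideal_span_base.
by have -> : z - (c + w) = z - w - c by ring.
Qed.

End LiftedParameters.

(** * From regular chains to parameters *)

Lemma quotient_map_eq (A : comPzRingType) (I : ideal A) x y :
  quotient_map I x = quotient_map I y <-> I (x - y).
Proof.
by split=> [/eqP|Ixy]; [move/quotient_eqP | apply/eqP/quotient_eqP].
Qed.

Lemma quotient_map_eq0 (A : comPzRingType) (I : ideal A) x :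
  quotient_map I x = 0 <-> I x.
Proof. by rewrite -{1}(rmorph0 (quotient_map I)) quotient_map_eq subr0. Qed.

Lemma quotient_map_surj (A : comPzRingType) (I : ideal A) (r : quotient_ring I)
  : exists x, quotient_map I x = r.
Proof. by exists (repr r); apply: reprK. Qed.

Lemma prime_ideal_cancel (A : comPzRingType) (P : ideal A) x a :
  prime_ideal P -> ~ P x -> P (x * a) -> P a.
Proof. by move=> [_ PM] nx /PM[]. Qed.

Lemma adjoin_ext (A : comPzRingType) (I J : ideal A) x :
  I = J :> set A -> adjoin I x = adjoin J x :> set A.
Proof. by move=> IJ; apply/seteqP; split => y [a]; [rewrite IJ|rewrite -IJ];
  exists a. Qed.

Section Quotient.
Variables (A : comPzRingType) (I : ideal A).
Local Notation B := (quotient_ring I).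
Local Notation pi := (quotient_map I).

Definition quotient_preim (J : ideal B) : ideal A.
Proof.
exists (fun x => J (pi x)) => [|x y Jx Jy|a x Jx].
- by rewrite rmorph0; apply: ideal0.
- by rewrite rmorphD; apply: idealD.
- by rewrite rmorphM; apply: idealM.
Defined.

Definition quotient_im (J : ideal A) : ideal B.
Proof.
exists (fun r => exists2 x, J x & pi x = r) =>
  [|_ _ [x Jx <-] [y Jy <-]|r _ [x Jx <-]].
- by exists 0; [apply: ideal0 | rewrite rmorph0].
- by exists (x + y); [apply: idealD | rewrite rmorphD].
- have [a <-] := quotient_map_surj r.
  by exists (a * x); [apply: idealM | rewrite rmorphM].
Defined.

Lemma quotient_preim_base (J : ideal B) : I `<=` quotient_preim J.
Proof. by move=> x /quotient_map_eq0 /= ->; apply: ideal0. Qed.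

Lemma quotient_im_mem (J : ideal A) x : I `<=` J -> quotient_im J (pi x) -> J x.
Proof.
by move=> IJ [y Jy /esym/quotient_map_eq/IJ xy]; apply: ideal_sub xy Jy.
Qed.

Lemma quotient_preim_prime (J : ideal B) : prime_ideal J ->
  prime_ideal (quotient_preim J).
Proof.
move=> [J1 JM]; split=> [|x y] /=; first by rewrite rmorph1.
by rewrite rmorphM => /JM.
Qed.

Lemma quotient_preim_proper (J J' : ideal B) : J `<` J' ->
  quotient_preim J `<` quotient_preim J'.
Proof.
rewrite !properEneq => -[/eqP JJ' sub]; split; last by move=> x /= /sub.
apply/eqP => e; apply: JJ'; apply/seteqP; split=> // r J'r.
have [x xr] := quotient_map_surj r; subst r.
by rewrite -[J _]/(quotient_preim J x) e.
Qed.

Lemma quotient_preim_maximal (J : ideal B) :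
  maximal_ideal J -> maximal_ideal (quotient_preim J).
Proof.
move=> [J1 Jmax]; split=> [|L JL L1]; first by rewrite /= rmorph1.
have IL : I `<=` L by move=> x /quotient_preim_base /JL.
move=> x Lx; apply: (Jmax (quotient_im L)); last by exists x.
  move=> r Jr; have [z zr] := quotient_map_surj r; exists z => //.
  by apply: JL; rewrite /= zr.
by rewrite -(rmorph1 pi) => /(quotient_im_mem IL).
Qed.

Lemma quotient_preim_gen (s : seq B) (J : ideal B) :
  J = ideal_gen [set` s] :> set B ->
  quotient_preim J = ideal_span I (map (@repr _ _) s) :> set A.
Proof.
move=> Js.
have sub : J `<=` quotient_im (ideal_span I (map (@repr _ _) s)).
  rewrite Js; apply: ideal_gen_sub => r rs; exists (repr r); last exact: reprK.
  by apply: ideal_span_mem; apply: map_f.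
apply/seteqP; split=> [x /sub|].
  by apply: quotient_im_mem; apply: ideal_span_base.
apply: ideal_span_sub => [|_ /mapP[r rs ->]]; first exact: quotient_preim_base.
by rewrite /= [quotient_map _ _]reprK Js; apply: sub_ideal_gen.
Qed.

End Quotient.

Lemma maximal_ideal_over (A : comPzRingType) (J : ideal A) :
  ~ J 1 -> exists2 M, maximal_ideal M & J `<=` M.
Proof.
move=> J1.
pose T := {I : ideal A | J `<=` I /\ ~ I 1}.
pose le (X Y : T) := `[< sval X `<=` sval Y >].
have J0 : J `<=` J /\ ~ J 1 by split.
have [||F Ftot|[M [JM M1]] Mmax] := @ZL_preorder T (exist _ J J0) le.
- by move=> ?; apply/asboolP.
- by move=> X Y Z /asboolP XY /asboolP YZ; apply/asboolP => x /XY /YZ.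
- pose U x := J x \/ exists2 X, F X & sval X x.
  have UD x y : U x -> U y -> U (x + y).
    move=> [Jx|[X FX Xx]] [Jy|[Y FY Yy]].
    + by left; apply: idealD.
    + by right; exists Y => //; apply: idealD => //; apply: (proj1 (svalP Y)).
    + by right; exists X => //; apply: idealD => //; apply: (proj1 (svalP X)).
    + case: (Ftot X Y FX FY) => /asboolP sub.
        by right; exists Y => //; apply: idealD => //; apply: sub.
      by right; exists X => //; apply: idealD => //; apply: sub.
  have UM a x : U x -> U (a * x).
    move=> [Jx|[X FX Xx]]; first by left; apply: idealM.
    by right; exists X => //; apply: idealM.
  have U0 : U 0 by left; apply: ideal0.
  have UJ : J `<=` Ideal U0 UD UM /\ ~ Ideal U0 UD UM 1.
    split=> [x Jx|[//|[X FX X1]]]; first by left.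
    exact: (proj2 (svalP X)) X1.
  exists (exist _ (Ideal U0 UD UM) UJ) => X FX.
  by apply/asboolP => x Xx; right; exists X.
exists M => //; split=> // L ML L1.
have JL : J `<=` L /\ ~ L 1 by split=> // x /JM /ML.
have := Mmax (exist _ L JL).
by rewrite /le /= => h; apply/asboolP/h/asboolP.
Qed.

Lemma local_unit (A : comPzRingType) (M : ideal A) a :
  is_local M -> ~ M a -> exists b, b * a = 1.
Proof.
move=> [_ Muniq] nMa.
have [|a1] := pselect (adjoin (zero_ideal A) a 1).
  by move=> [b /subr0_eq ba]; exists b.
have [N Nmax aN] := maximal_ideal_over a1.
by case: nMa; rewrite -(Muniq N Nmax); apply/aN/adjoinr.
Qed.

(** The invariant that passes through completion, localisation and quotients. Only the indices up to
    [n] are constrained. *)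
Record param_chain (A : comPzRingType) (n : nat) (p : nat -> ideal A)
    (x : nat -> A) : Prop := ParamChain {
  pc_zero : forall a, p 0%N a -> a = 0;
  pc_succ : forall i, (i < n)%N -> p i.+1 = adjoin (p i) (x i) :> set A;
  pc_prime : forall i, (i <= n)%N -> prime_ideal (p i);
  pc_notin : forall i, (i < n)%N -> ~ p i (x i);
  pc_field : forall a, ~ p n a -> exists b, p n (b * a - 1) }.

Definition chain_nat n (A : ring_chain n) (i : nat) : ideal A :=
  chain_ideal A (inord i).

Section RegularChain.
Variables (n : nat) (A : ring_chain n).
Hypothesis regA : regular_chain A.
Let p := chain_nat A.

Let p_prime i : prime_ideal (p i).
Proof. by case: regA => _ + _ _; apply. Qed.

Let p_lt i j : (i < j <= n)%N -> p i `<` p j.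
Proof.
move=> /andP[ij jn]; case: regA => _ _ + _; apply.
by rewrite !inordK // ltnS ltnW // (leq_trans ij).
Qed.

Let p_le i j : (i <= j <= n)%N -> p i `<=` p j.
Proof.
by move=> /andP[]; rewrite leq_eqVlt => /predU1P[-> _ //|ij jn];
  apply: properW; apply: p_lt; rewrite ij.
Qed.

(** Primes of the quotient are pulled back to [A] and the chain is continued downwards by the [p k]
    with [k < i]. *)
Let quotient_dim i d : (i <= n)%N ->
  has_prime_chain (quotient_ring (p i)) d -> (i + d <= n)%N.
Proof.
move=> lin [q [q_prime q_lt]]; case: regA => -[_ [_ dimA]] _ _ _; apply: dimA.
exists (fun k => if (k < i)%N then p k else quotient_preim (q (inord (k - i)))).
split=> [k|k l kl].
  by case: ifP => _ //; apply: quotient_preim_prime.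
have [li|il] := ltnP l i.
  by rewrite (ltn_trans kl li); apply: p_lt; rewrite kl ltnW // (leq_trans li).
have [ki|ik] := ltnP k i; last first.
  apply: quotient_preim_proper; apply: q_lt.
  by have lk := ltn_ord k; have ll := ltn_ord l; rewrite !inordK; lia.
have [pki npki] : p k `<` p i by apply: p_lt; rewrite ki.
have sub := @quotient_preim_base _ (p i).
split=> [x /pki|h]; first exact: sub.
by apply: npki => x /sub /h.
Qed.

Let M_gen : exists2 M : ideal A, is_local M &
  (exists2 s : seq A, (size s <= n)%N & M = ideal_gen [set` s] :> set A) /\
  forall i, (i <= n)%N ->
    exists2 s : seq A, (size s + i <= n)%N & M = ideal_span (p i) s :> set A.
Proof.
case: regA => -[[_ [M [d [locM [dimd _] [s Ms]]]]] [_ dimA]] _ _ regq.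
exists M => //; split=> [|i lin].
  by exists s => //; rewrite size_tuple; apply: dimA.
have [_ [N [e [[Nmax _] [/quotient_dim-/(_ lin) ei _] [t Nt]]]]] :=
  regq (inord i).
exists (map (@repr _ _) t); first by rewrite size_map size_tuple addnC.
rewrite -(quotient_preim_gen Nt); apply/esym.
by apply: (proj2 locM); apply: quotient_preim_maximal.
Qed.

Let fg (I : ideal A) : exists s : seq A, I = ideal_gen [set` s] :> set A.
Proof. by case: regA => -[[]]. Qed.

Lemma regular_chain_param : exists x, param_chain n p x.
Proof.
have [M locM [[s0 s0n Ms0] Mgen]] := M_gen.
have M1 : ~ M 1 by case: locM => -[].
have M_unit a : ~ M a -> exists b, b * a = 1 by apply: local_unit.
have pnM : p n = M :> set A.
  have [s sn ->] := Mgen n (leqnn n).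
  by have /nilP -> : nilp s by rewrite /nilp; lia.
have pn1 : ~ p n 1 by rewrite pnM.
have pn_unit a : ~ p n a -> exists b, b * a = 1 by rewrite pnM; apply: M_unit.
(* [span_of_regular_quotient] for the chain shifted to start at [p i]. *)
have step i x : (i <= n)%N ->
    (forall j, (i <= j < n)%N -> p j.+1 = adjoin (p j) (x j) :> set A) ->
    forall (K : ideal A) s, K `<=` p i -> M = ideal_span K s :> set A ->
    exists2 t, (size t + (n - i) = size s)%N & p i = ideal_span K t :> set A.
  move=> lin pS K s Kp Ms.
  pose p' j := p (i + j)%N; pose x' j := x (i + j)%N.
  have p'n : p' (n - i)%N = p n by rewrite /p' subnKC.
  have p'S j : (j < n - i)%N -> p' j.+1 = adjoin (p' j) (x' j) :> set A.
    by move=> jn; rewrite /p' addnS pS //; lia.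
  have x'_reg j a : (j < n - i)%N -> p' j (x' j * a) -> p' j a.
    move=> jn; apply: prime_ideal_cancel; first exact: p_prime.
    move=> px; have [] : p' j `<` p' j.+1 by apply: p_lt; lia.
    by move=> _; apply; rewrite p'S //; apply: adjoin_sub.
  have [|||||t st] := span_of_regular_quotient p'S x'_reg _ _ _ _ _ (K := K)
    (s := s).
  - by rewrite p'n.
  - by rewrite p'n.
  - by rewrite /p' addn0.
  - by rewrite p'n pnM.
  - exact: fg.
  by rewrite /p' addn0 => pt; exists t.
have [x pS] : exists x, forall i, (i < n)%N -> p i.+1 = adjoin (p i) (x i)
  :> set A.
  suff: forall d, (d <= n)%N -> exists x, forall j, (n - d <= j < n)%N ->
      p j.+1 = adjoin (p j) (x j) :> set A.
    by move=> /(_ n (leqnn n))[x]; rewrite subnn => xP; exists x.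
  elim=> [|d IHd] dn; first by exists (fun=> 0) => j; lia.
  have [x xP] := IHd (ltnW dn); set i := (n - d.+1)%N.
  have eid : (n - d = i.+1)%N by rewrite /i; lia.
  have lin : (i < n)%N by rewrite /i; lia.
  rewrite eid in xP.
  (* [s] has at most [n - i] elements and [n - i.+1] of them are exchanged, so at most one is left;
     strict inclusion excludes none. *)
  have [s si Ms] := Mgen i (ltnW lin).
  have [|t ts pt] := step _ x lin xP (p i) s _ Ms.
    by apply: p_le; rewrite leqnSn.
  have [y py] : exists y, p i.+1 = adjoin (p i) y :> set A.
    case: t ts pt => [|y [|z t]] /= ts pt; last by lia.
      have [] : p i `<` p i.+1 by apply: p_lt; rewrite leqnn.
      by rewrite pt => _ [].
    by exists y.
  exists (fun j => if j == i then y else x j) => j jP.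
  have [->|ji] := eqVneq j i; first exact: py.
  by apply: xP; lia.
exists x; split=> // [a|i lin|a /pn_unit[b ab]]; last 1 first.
- by exists b; rewrite ab subrr; apply: ideal0.
(* At most [n] generators and [n] exchanges: nothing is left to generate [p 0]. *)
- have [|||t ts pt] := step 0%N x (leq0n n) _ (zero_ideal A) s0 _ _.
  + by move=> j; apply: pS.
  + by move=> _ ->; apply: ideal0.
  + by rewrite ideal_span_gen.
  rewrite pt; case: t ts {pt} => [|y t] /=; last by lia.
  by [].
- move=> px; have [] : p i `<` p i.+1 by apply: p_lt; rewrite leqnn.
  by move=> _; apply; rewrite pS //; apply: adjoin_sub.
Qed.
End RegularChain.

(** * Completion *)

Section CompletionTheory.
Variables (A : comPzRingType) (I : ideal A).
Implicit Types (a b : completion I) (u v : nat -> A) (P : ideal A).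

(** Elements of the completion are handled through bare sequences, which keeps Cauchy proofs out of
    the statements. *)
Definition cauchy_rep a u :=
  exists h : cauchy I u, quotient_map (null_ideal I) (CauchySeq h) = a.

Definition eventually_in P u :=
  forall k, exists N, forall i, (N <= i)%N -> ideal_add P (ideal_pow I k) (u i).

Definition null u :=
  forall k, exists N, forall i, (N <= i)%N -> ideal_pow I k (u i).

Lemma cauchy_rep_ex u : (forall k, exists N, forall i j,
  (N <= i)%N -> (N <= j)%N -> ideal_pow I k (u i - u j)) ->
  exists a, cauchy_rep a u.
Proof.
move=> uC; have h : cauchy I u by apply/asboolP.
by exists (quotient_map (null_ideal I) (CauchySeq h)), h.
Qed.

Lemma cauchy_rep_cst x : cauchy_rep (to_completion I x) (fun=> x).
Proof. by exists (cauchy_cst I x). Qed.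

Lemma cauchy_repB a b u v : cauchy_rep a u -> cauchy_rep b v ->
  cauchy_rep (a - b) (fun i => u i - v i).
Proof.
move=> [hu <-] [hv <-].
have h : cauchy I (fun i => u i - v i).
  exact: (cauchy_funP (CauchySeq hu - CauchySeq hv)).
exists h; rewrite -rmorphB; congr (quotient_map _ _); exact: val_inj.
Qed.

Lemma cauchy_repD a b u v : cauchy_rep a u -> cauchy_rep b v ->
  cauchy_rep (a + b) (fun i => u i + v i).
Proof.
move=> [hu <-] [hv <-].
have h : cauchy I (fun i => u i + v i).
  exact: (cauchy_funP (CauchySeq hu + CauchySeq hv)).
exists h; rewrite -rmorphD; congr (quotient_map _ _); exact: val_inj.
Qed.

Lemma cauchy_repM a b u v : cauchy_rep a u -> cauchy_rep b v ->
  cauchy_rep (a * b) (fun i => u i * v i).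
Proof.
move=> [hu <-] [hv <-].
have h : cauchy I (fun i => u i * v i).
  exact: (cauchy_funP (CauchySeq hu * CauchySeq hv)).
exists h; rewrite -rmorphM; congr (quotient_map _ _); exact: val_inj.
Qed.

Lemma cauchy_rep_eq0 a u : cauchy_rep a u -> a = 0 <-> null u.
Proof. by move=> [h <-]; rewrite quotient_map_eq0. Qed.

Lemma cauchy_rep_eq a b u v : cauchy_rep a u -> cauchy_rep b v ->
  null (fun i => u i - v i) -> a = b.
Proof.
by move=> au bv /(cauchy_rep_eq0 (cauchy_repB au bv))/subr0_eq.
Qed.

(** With this rate the term of index [k] agrees with the limit modulo the k-th power, so membership
    in a closed ideal can be tested term by term. *)
Definition fast u := forall k, ideal_pow I k (u k.+1 - u k).

Lemma fastB u k j : fast u -> (k <= j)%N -> ideal_pow I k (u j - u k).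
Proof.
move=> uf; elim: j => [|j IHj].
  by rewrite leqn0 => /eqP ->; rewrite subrr; apply: ideal0.
rewrite leq_eqVlt => /predU1P[->|kj]; first by rewrite subrr; apply: ideal0.
have -> : u j.+1 - u k = u j.+1 - u j + (u j - u k) by ring.
by apply: idealD; [apply: ideal_pow_le (uf j) | apply: IHj].
Qed.

Lemma fast_rep u : fast u -> exists a, cauchy_rep a u.
Proof.
move=> uf; apply: cauchy_rep_ex => k; exists k => i j ki kj.
have -> : u i - u j = (u i - u k) - (u j - u k) by ring.
by apply: idealB; apply: fastB.
Qed.

Lemma cauchy_rep_fast a : exists2 u, fast u & cauchy_rep a u.
Proof.
have [[u uC] ua] := quotient_map_surj a.
move/asboolP: (uC) => /choice[N uN].
pose N' k := (\max_(j < k.+1) N j)%N.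
have NN' k j : (k <= j)%N -> (N k <= N' j)%N.
  by rewrite -ltnS => kj; apply: (leq_bigmax (Ordinal kj)).
pose v k := u (N' k).
have vf : fast v by move=> k; apply: uN; apply: NN'; rewrite // leqnSn.
have [b bv] := fast_rep vf; exists v => //.
suff -> : a = b by [].
have au : cauchy_rep a u by exists uC.
apply: cauchy_rep_eq au bv _ => k; exists (maxn (N k) k) => i.
by rewrite geq_max => /andP[Ni ki]; apply: uN => //; apply: NN'.
Qed.

Lemma eventually_inD P u v :
  eventually_in P u -> eventually_in P v -> eventually_in P (fun i =>
    u i + v i).
Proof.
move=> uP vP k; have [N uN] := uP k; have [M vM] := vP k.
exists (maxn N M) => i; rewrite geq_max => /andP[Ni Mi].
by apply: idealD; [apply: uN | apply: vM].
Qed.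

Lemma eventually_inM P u v :
  eventually_in P v -> eventually_in P (fun i => u i * v i).
Proof.
move=> vP k; have [M vM] := vP k.
by exists M => i Mi; apply: idealM; apply: vM.
Qed.

Lemma null_eventually P u : null u -> eventually_in P u.
Proof.
by move=> u0 k; have [N uN] := u0 k; exists N => i Ni; apply/ideal_addr/uN.
Qed.

(** The topological closure of the extension of [P]. *)
Definition closed_ext P : ideal (completion I).
Proof.
exists (fun a => exists2 u, cauchy_rep a u & eventually_in P u).
- exists (fun=> 0); last by move=> k; exists 0%N => i _; apply: ideal0.
  by rewrite -(rmorph0 (to_completion I)); apply: cauchy_rep_cst.
- move=> a b [u au uP] [v bv vP]; exists (fun i => u i + v i).
    exact: cauchy_repD.
  exact: eventually_inD.
- move=> a b [v bv vP]; have [u _ au] := cauchy_rep_fast a.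
  exists (fun i => u i * v i); first exact: cauchy_repM.
  exact: eventually_inM.
Defined.

Lemma closed_extP P a u : cauchy_rep a u -> closed_ext P a <->
  eventually_in P u.
Proof.
move=> au; split=> [[v av vP]|]; last by exists u.
have /cauchy_rep_eq0[/(_ (subrr _)) uv _] := cauchy_repB au av.
move=> k; have [N uN] := eventually_inD vP (null_eventually P uv) k.
by exists N => i /uN; rewrite addrC subrK.
Qed.

Lemma closed_ext_fast P a u : fast u -> cauchy_rep a u ->
  closed_ext P a <-> forall k, ideal_add P (ideal_pow I k) (u k).
Proof.
move=> uf au; rewrite (closed_extP P au); split=> uP k.
  have [N uN] := uP k.
  apply: (@ideal_sub _ _ _ (u (maxn N k))); last by apply: uN; rewrite leq_maxl.
  by apply: ideal_addr; rewrite -opprB; apply: idealN; apply: fastB;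
    rewrite // leq_maxr.
exists k => i ki; apply: ideal_sub (uP k).
by apply: ideal_addr; apply: fastB.
Qed.

Lemma closed_ext_cst P x :
  closed_ext P (to_completion I x) <-> forall k, ideal_add P (ideal_pow I k) x.
Proof.
apply: closed_ext_fast (cauchy_rep_cst x) => k.
by rewrite subrr; apply: ideal0.
Qed.

Lemma ext_closed_ext P : ideal_ext (to_completion I) P `<=` closed_ext P.
Proof.
apply: ideal_gen_sub => _ [x Px <-]; apply/closed_ext_cst => k.
exact: ideal_addl.
Qed.

Lemma closed_ext0 P a : (forall x, P x -> x = 0) -> closed_ext P a -> a = 0.
Proof.
move=> P0 [u au uP]; apply/(cauchy_rep_eq0 au) => k.
have [N uN] := uP k; exists N => i /uN[y /P0 ->].
by rewrite subr0.
Qed.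

End CompletionTheory.

(** * The completion of a parameter chain *)

Section CompletionChain.
Variables (A : comPzRingType) (n : nat) (p : nat -> ideal A) (x : nat -> A).
Hypothesis pc : param_chain n p x.
Let I := p n.
Let cl i := closed_ext I (p i).

Let pS i : (i < n)%N -> p i.+1 = adjoin (p i) (x i) :> set A.
Proof. exact: (pc_succ pc). Qed.

Lemma param_chain_reg i a : (i < n)%N -> p i (x i * a) -> p i a.
Proof.
move=> lin; apply: prime_ideal_cancel; first exact: (pc_prime pc (ltnW lin)).
exact: (pc_notin pc lin).
Qed.

Let x_reg := param_chain_reg.

(** Divide a sequence in the closure by [x i] term by term. By [colon_firstP] the quotients are
    determined modulo [p i] with a loss of one degree, so corrections in [p i] turn them into a
    Cauchy sequence. *)
Lemma closed_ext_succ i : (i < n)%N ->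
  cl i.+1 = adjoin (cl i) (to_completion I (x i)) :> set (completion I).
Proof.
move=> lin; apply/seteqP; split; last first.
  apply: adjoin_sub => [a [u au uP]|].
    exists u => // k; have [N uN] := uP k; exists N => j /uN.
    by apply: ideal_addS => //; apply: (chain_le pS); rewrite leqnSn.
  by apply/closed_ext_cst => k; apply/ideal_addl/(chain_mem pS); rewrite leqnn.
move=> a /= clia; have [u uf au] := cauchy_rep_fast a.
have /closed_ext_fast-/(_ _ uf au) uP := clia.
pose T k c := ideal_add (p i) (ideal_pow I k) (u k - x i * c).
have T_ex k : exists c, T k c.
  have [b] := uP k; rewrite pS // => -[c pb] pub; exists c;
    exists (b - c * x i) => //.
  by have -> : u k - x i * c - (b - c * x i) = u k - b by ring.
have T_step k c : T k.+1 c ->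
    exists2 c', T k.+2 c' & ideal_pow I k (c' - c).
  move=> Tc; have [d Td] := T_ex k.+2.
  have : ideal_add (p i) (ideal_pow I k.+1) (x i * (d - c)).
    have -> : x i * (d - c) = (u k.+1 - x i * c) + (u k.+2 - u k.+1)
      - (u k.+2 - x i * d).
      by ring.
    apply: idealB; last by apply: ideal_addS Td => //; apply: ideal_powS.
    by apply: idealD => //; apply: ideal_addr.
  move=> /(colon_firstP pS x_reg (leqnn n) lin)[e pe Ie].
  exists (d - e); last by rewrite addrAC.
  rewrite /T;
    have -> : u k.+2 - x i * (d - e) = u k.+2 - x i * d + x i * e by ring.
  by apply: idealD => //; apply/ideal_addl/idealM.
have [c0 Tc0] := T_ex 1%N.
have [c [cT cf]] : exists c, (forall k, T k.+1 (c k)) /\ fast I c.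
  (* The default 0 makes the step total, as [choice] requires. *)
  have {}T_step k c : exists c', T k.+1 c ->
    T k.+2 c' /\ ideal_pow I k (c' - c).
    have [/T_step[c' ? ?]|nT] := pselect (T k.+1 c); first by exists c'.
    by exists 0.
  have /choice[F FP] : forall kc : nat * A, exists c', T kc.1.+1 kc.2 ->
      T kc.1.+2 c' /\ ideal_pow I kc.1 (c' - kc.2) by move=> [k c];
        apply: T_step.
  pose c k := iteri k (fun k c => F (k, c)) c0.
  have cT k : T k.+1 (c k).
    by elim: k => [|k IHk] //=; have [] := FP (k, c k) IHk.
  by exists c; split=> // k; have [] := FP (k, c k) (cT k).
have [b bc] := fast_rep cf; exists b.
exists (fun j => u j - c j * x i).
  by apply: cauchy_repB => //; apply: cauchy_repM => //; apply: cauchy_rep_cst.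
move=> k; exists k => j kj.
have -> : u j - c j * x i = (u j.+1 - x i * c j) - (u j.+1 - u j) by ring.
apply: idealB; last by apply/ideal_addr/(ideal_pow_le kj).
by apply: ideal_addS (cT j) => //; apply: ideal_pow_le; rewrite (leq_trans kj).
Qed.

(** Both sides acquire the same generator from [i] to [i.+1], and the closure of zero is zero. *)
Lemma ideal_ext_completion i : (i <= n)%N ->
  ideal_ext (to_completion I) (p i) = cl i :> set (completion I).
Proof.
elim: i => [|i IHi] lin; apply/seteqP; split=> [|a]; try exact: ext_closed_ext.
  by move=> /(closed_ext0 (pc_zero pc)) ->; apply: ideal0.
have IH := IHi (ltnW lin).
have -> : cl i.+1 a = adjoin (cl i) (to_completion I (x i)) a.
  by rewrite (closed_ext_succ lin).
case=> b; have -> : forall z, cl i z = ideal_ext (to_completion I) (p i) z.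
  by move=> z; rewrite IH.
move=> pab.
have sub : ideal_ext (to_completion I) (p i) `<=` ideal_ext (to_completion I)
  (p i.+1).
  apply: ideal_gen_sub => _ [y py <-]; apply: sub_ideal_gen; exists y => //.
  by apply: (chain_le pS) py; rewrite leqnSn.
apply: ideal_sub (sub _ pab) _; apply: idealM; apply: sub_ideal_gen.
by exists (x i) => //; apply: (chain_mem pS); rewrite leqnn.
Qed.

(** Primality is [filtration_prime] at a late common index; [x i] is kept out of the closure of
    [p i] already modulo the square of [p n]; inverses modulo [p n] are read off the term of index
    1. *)
Lemma completion_param_chain :
  param_chain n (fun i => ideal_ext (to_completion I) (p i))
    (to_completion I \o x).
Proof.
have pn1 : ~ p n 1 by case: (pc_prime pc (leqnn n)).
split=> [a|i lin|i lin|i lin|a].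
- by rewrite ideal_ext_completion // => /(closed_ext0 (pc_zero pc)).
- rewrite ideal_ext_completion // closed_ext_succ //.
  by apply: adjoin_ext; rewrite ideal_ext_completion // ltnW.
- have clE := ideal_ext_completion lin; rewrite /prime_ideal clE;
  split=> [|a b].
    rewrite -(rmorph1 (to_completion I)) =>
      /closed_ext_cst/(_ 1%N)[y py /ideal_pow1 Iy].
    by apply: pn1; apply: ideal_sub Iy _; apply: (chain_le pS) py;
      rewrite lin /=.
  have [u uf au] := cauchy_rep_fast a; have [v vf bv] := cauchy_rep_fast b.
  rewrite (closed_extP _ (cauchy_repM au bv)).
  rewrite (closed_ext_fast _ uf au) (closed_ext_fast _ vf bv) => abP.
  have [|/existsNP[k uk]] := pselect (forall k, ideal_add (p i) (ideal_pow I k)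
    (u k)).
    by left.
  right => l; apply: contrapT => vl; have [N uvN] := abP (k + l)%N.
  have pnp := pc_prime pc (leqnn n); set m := maxn N (maxn k l).
  have [|uk'|vl'] := @filtration_prime _ _ _ _ pS x_reg pnp i k l (u m) (v m)
    lin.
  + by apply: uvN; rewrite leq_maxl.
  + apply: uk; rewrite -[u k](subKr (u m)); apply: idealB => //;
    apply: ideal_addr.
    by apply: fastB => //; rewrite /m !leq_max leqnn orbT.
  + apply: vl; rewrite -[v l](subKr (v m)); apply: idealB => //;
    apply: ideal_addr.
    by apply: fastB => //; rewrite /m !leq_max leqnn !orbT.
- rewrite ideal_ext_completion ?(ltnW lin) //= => /closed_ext_cst/(_ 2%N).
  exact: (notin_square pS x_reg lin pn1).
- rewrite ideal_ext_completion // => na.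
  have [u uf au] := cauchy_rep_fast a.
  have u1 j : (0 < j)%N -> p n (u j - u 1%N).
    by move=> j0; apply: ideal_pow1; apply: fastB.
  have nu1 : ~ p n (u 1%N).
    move=> pu; apply: na; apply/(closed_extP _ au) => k; exists 1%N => j j0.
    by apply/ideal_addl/(ideal_sub (u1 j j0)).
  have [b pb] := pc_field pc nu1; exists (to_completion I b).
  rewrite -(rmorph1 (to_completion I)).
  exists (fun j => b * u j - 1).
    by apply: cauchy_repB (cauchy_rep_cst I 1); apply: cauchy_repM au;
      apply: cauchy_rep_cst.
  move=> k; exists 1%N => j j0; apply: ideal_addl.
  have -> : b * u j - 1 = b * (u j - u 1%N) + (b * u 1%N - 1) by ring.
  by apply: idealD => //; apply/idealM/u1.
Qed.

End CompletionChain.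

(** * Localisation *)

Section LocalizationTheory.
Variables (A : comPzRingType) (S : set A).

Lemma localization_unit s : mul_closure S s ->
  exists r : localization S, r * to_localization S s = 1.
Proof.
move=> Ss; exists (\pi_(localization S) (Defs.frac 1 Ss)).
rewrite -[LHS]/(locmul _ _) -[RHS]/(loc1 S) !piE.
by apply: frac_eq => /=; ring.
Qed.

Lemma localization_frac (f : localization S) :
  exists a, exists2 s, mul_closure S s &
    f * to_localization S s = to_localization S a.
Proof.
exists (fnum (repr f)), (fden (repr f)); first exact: fden_closure.
rewrite -[LHS]/(locmul _ _) -{1}[f]reprK !piE.
by apply: frac_eq => /=; ring.
Qed.

Lemma to_localization_eq0 a :
  to_localization S a = 0 <-> exists2 u, mul_closure S u & u * a = 0.
Proof.
split.
  rewrite -[RHS]/(loc0 S) !piE => /eqP/localization_eqP[u Su /= ua].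
  by exists u => //; rewrite -[RHS]ua; ring.
move=> [u Su ua]; rewrite -[RHS]/(loc0 S) !piE.
by apply/eqP/localization_eqP; exists u => //=; rewrite -[RHS]ua; ring.
Qed.

End LocalizationTheory.

Section PrimeLocalization.
Variables (A : comPzRingType) (Q : ideal A).
Hypothesis Q_prime : prime_ideal Q.
Local Notation L := (localization (~` Q)).
Local Notation toL := (to_localization (~` Q)).

Lemma prime_localization_div s (f : L) : ~ Q s -> exists g, g * toL s = f.
Proof.
move=> Qs; have [|r rs] := @localization_unit _ (~` Q) s.
  by rewrite mul_closure_prime.
by exists (f * r); rewrite -mulrA rs mulr1.
Qed.

Lemma prime_localization_frac (f : L) :
  exists a, exists2 s, ~ Q s & f * toL s = toL a.
Proof. by have := localization_frac f; rewrite mul_closure_prime. Qed.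

Lemma prime_to_localization_eq0 a :
  toL a = 0 <-> exists2 u, ~ Q u & u * a = 0.
Proof. by rewrite to_localization_eq0 mul_closure_prime. Qed.

Lemma prime_ideal_notin (P : ideal A) s a :
  prime_ideal P -> P `<=` Q -> ~ Q s -> P (s * a) -> P a.
Proof. by move=> [_ PM] PQ Qs /PM[/PQ|]. Qed.

(** Fractions having some numerator in [P] form an ideal, and primality of [P] carries membership
    over to every other presentation. *)
Lemma ideal_ext_localization (P : ideal A) (f : L) a s :
  prime_ideal P -> P `<=` Q -> ~ Q s -> f * toL s = toL a ->
  ideal_ext toL P f <-> P a.
Proof.
move=> P_prime PQ Qs fsa; split=> [|Pa]; last first.
  have [r rs] := prime_localization_div 1 Qs.
  rewrite -[f]mulr1 -rs mulrCA fsa; apply/idealM/sub_ideal_gen.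
  by exists a.
pose J (g : L) := exists b, exists2 t, P b /\ ~ Q t & g * toL t = toL b.
have J0 : J 0.
  exists 0, 1; last by rewrite mul0r rmorph0.
  by split; [apply: ideal0 | apply: Q_prime.1].
have JD g h : J g -> J h -> J (g + h).
  move=> [b [t [Pb Qt] gb]] [c [u [Pc Qu] hc]]; exists (b * u + c * t), (t * u).
    by split; [apply: idealD; apply: ideal_mulr | case/Q_prime.2].
  rewrite rmorphD !rmorphM /= -gb -hc; ring.
have JM g h : J h -> J (g * h).
  have [c [u Qu gc]] := prime_localization_frac g.
  move=> [b [t [Pb Qt] hb]]; exists (c * b), (u * t).
    by split; [apply: idealM | case/Q_prime.2].
  by rewrite !rmorphM /= -gc -hb; ring.
have /[apply] : ideal_ext toL P `<=` Ideal J0 JD JM.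
  apply: ideal_gen_sub => _ [b Pb <-]; exists b, 1.
    by split=> //; apply: Q_prime.1.
  by rewrite rmorph1 mulr1.
move=> [b [t [Pb Qt] ftb]].
have /prime_to_localization_eq0[u Qu] : toL (a * t - b * s) = 0.
  by rewrite rmorphB !rmorphM /= -fsa -ftb; ring.
rewrite mulrBr => /subr0_eq uE.
have := prime_ideal_notin P_prime PQ; move=> PQ'.
apply: (PQ' t) => //; apply: (PQ' u) => //; rewrite (mulrC t) uE.
by apply/idealM/ideal_mulr.
Qed.

End PrimeLocalization.

Lemma localization_param_chain (A : comPzRingType) n p x :
  param_chain n.+1 p x -> 
  param_chain n (fun i => ideal_ext (to_localization (~` (p n : ideal A)))
    (p i))
    (to_localization (~` p n) \o x).
Proof.
move=> pc; set Q := p n.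
have pS := pc_succ pc; have p_prime := pc_prime pc.
have Q_prime : prime_ideal Q by apply: p_prime.
have pQ i : (i <= n)%N -> p i `<=` Q by move=> lin; apply: (chain_le pS);
  rewrite lin ltnW.
have extP i f a s (lin : (i <= n)%N) (Qs : ~ Q s) (fE : f * _ s = _ a) :=
  ideal_ext_localization Q_prime (p_prime i (leqW lin)) (pQ i lin) Qs fE.
have Q1 := Q_prime.1.
have fE1 a : to_localization (~` Q) a * to_localization (~` Q)
  1 = to_localization (~` Q) a.
  by rewrite rmorph1 mulr1.
split=> [f|i lin|i lin|i lin|f].
- have [a [s Qs fE]] := prime_localization_frac Q_prime f.
  move=> /(extP _ _ _ _ (leq0n n) Qs fE)/(pc_zero pc) a0.
  have [r rs] := prime_localization_div Q_prime 1 Qs.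
  by rewrite -[f]mulr1 -rs mulrCA fE a0 rmorph0 mulr0.
- apply/seteqP; split=> [f|]; last first.
    apply: adjoin_sub => [f|]; last first.
      by apply/(extP _ _ _ _ lin Q1 (fE1 _)); apply: (chain_mem pS);
        rewrite leqnn ltnW.
    apply: ideal_gen_sub => _ [y py <-]; apply: sub_ideal_gen; exists y => //.
    by apply: (chain_le pS) py; rewrite leqnSn ltnW.
  have [a [s Qs fE]] := prime_localization_frac Q_prime f.
  move=> /(extP _ _ _ _ lin Qs fE); rewrite pS ?leqW // => -[b pab].
  have [g gb] := prime_localization_div Q_prime (to_localization _ b) Qs.
  have fgE : (f - g * to_localization (~` Q) (x i)) * to_localization (~` Q) s =
      to_localization (~` Q) (a - b * x i).
    by rewrite rmorphB rmorphM /= -gb -fE; ring.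
  by exists g; apply/(extP _ _ _ _ (ltnW lin) Qs fgE).
- split=> [|f g].
    by rewrite -(rmorph1 (to_localization _)) =>
      /(extP _ _ _ _ lin Q1 (fE1 _))/(p_prime i (leqW lin)).1.
  have [a [s Qs fE]] := prime_localization_frac Q_prime f.
  have [b [t Qt gE]] := prime_localization_frac Q_prime g.
  have Qst : ~ Q (s * t) by case/Q_prime.2.
  have fgE : f * g * to_localization (~` Q) (s * t) = to_localization (~` Q)
    (a * b).
    by rewrite !rmorphM /= -fE -gE; ring.
  rewrite (extP _ _ _ _ lin Qst fgE) (extP _ _ _ _ lin Qs fE)
    (extP _ _ _ _ lin Qt gE).
  exact: (p_prime i (leqW lin)).2.
- move=> /(extP _ _ _ _ (ltnW lin) Q1 (fE1 _)).
  exact: (pc_notin pc (ltnW lin)).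
- have [a [s Qs fE]] := prime_localization_frac Q_prime f.
  rewrite (extP _ _ _ _ (leqnn n) Qs fE) => Qa.
  have [g gE] := prime_localization_div Q_prime (to_localization _ s) Qa.
  have [r rs] := prime_localization_div Q_prime 1 Qs.
  exists g; suff -> : g * f - 1 = 0 by apply: ideal0.
  by rewrite -[X in _ - X]rs -gE -fE; rewrite -[g * f]mulr1 -rs; ring.
Qed.

(** * Ring correspondences *)

(* The correspondences used are graphs of surjective ring morphisms; as       *)
(* relations they pass to completions and localisations without any           *)
(* well-definedness check.                                                    *)
Record ring_corr (A B : comPzRingType) (R : A -> B -> Prop) : Prop := RingCorr {
  corr_total : forall a, exists b, R a b;
  corr_onto : forall b, exists a, R a b;
  corr_one : R 1 1;
  corrB : forall a b a' b', R a b -> R a' b' -> R (a - a') (b - b');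
  corrM : forall a b a' b', R a b -> R a' b' -> R (a * a') (b * b') }.

Section RingCorr.
Variables (A B : comPzRingType) (R : A -> B -> Prop).
Hypothesis RP : ring_corr R.

Lemma corr0 : R 0 0.
Proof. by have := corrB RP (corr_one RP) (corr_one RP); rewrite !subrr. Qed.

Lemma corrD a b a' b' : R a b -> R a' b' -> R (a + a') (b + b').
Proof.
move=> ab /(corrB RP corr0); rewrite !sub0r => /(corrB RP ab).
by rewrite !opprK.
Qed.

Lemma corr_iso : (forall a b, R a b -> a = 0 <-> b = 0) -> ring_iso A B.
Proof.
move=> R0; have [f fR] := choice (corr_total RP).
have [g gR] := choice (corr_onto RP).
have Runiq a b b' : R a b -> R a b' -> b = b'.
  move=> ab /(corrB RP ab); rewrite subrr => /R0[+ _] => /(_ erefl).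
  exact: subr0_eq.
have Rinj a a' b : R a b -> R a' b -> a = a'.
  move=> ab /(corrB RP ab); rewrite subrr => /R0[_] /(_ erefl).
  exact: subr0_eq.
have fB : zmod_morphism f by move=> a a'; apply: Runiq (fR _) _; apply: corrB.
have fM : monoid_morphism f.
  split=> [|a a']; apply: Runiq (fR _) _; first exact: corr_one.
  by apply: corrM.
pose fD := GRing.isZmodMorphism.Build A B f fB.
pose fX := GRing.isMonoidMorphism.Build A B f fM.
pose F : {rmorphism A -> B} := HB.pack f fD fX.
by exists F, g => [a|b];
  [apply: Rinj (gR _) (fR _) | apply: Runiq (fR _) (gR _)].
Qed.

End RingCorr.

(** [R] plays the graph of the map from [A] to [A/p_1], hence the shift of index. When [q 0] is
    zero, the clause at index 0 makes [R] single-valued with kernel [p 1]. *)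
Definition chain_corr n (A B : comPzRingType) (p : nat -> ideal A)
    (q : nat -> ideal B) (R : A -> B -> Prop) : Prop :=
  ring_corr R /\
  forall i a b, (i <= n)%N -> R a b -> p i.+1 a <-> q i b.

Section CompletionCorr.
Variables (n : nat) (A B : comPzRingType) (p : nat -> ideal A) (x : nat -> A).
Variables (q : nat -> ideal B) (y : nat -> B) (R : A -> B -> Prop).
Hypotheses (pcA : param_chain n.+1 p x) (pcB : param_chain n q y).
Hypothesis RP : chain_corr n p q R.
Let corrR := proj1 RP.
Let I := p n.+1.
Let J := q n.

Let R0 b : R 0 b -> b = 0.
Proof.
by move=> /(RP.2 0%N _ _ (leq0n n))[+ _] => /(_ (ideal0 _))/(pc_zero pcB).
Qed.

Let Runiq a b b' : R a b -> R a b' -> b = b'.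
Proof.
by move=> ab /(corrB corrR ab); rewrite subrr => /R0/subr0_eq.
Qed.

Let pow_im k a b : R a b -> ideal_pow I k a -> ideal_pow J k b.
Proof.
elim: k a b => [|k IHk] a b Rab; first by move=> _; apply: ideal_pow0.
pose L : ideal A := @Ideal _ [set a | forall b, R a b -> ideal_pow J k.+1 b]
  ltac:(by move=> c /R0 ->; exact: ideal0)
  ltac:(by move=> u v Lu Lv w Rw; have [c uc] := corr_total corrR u;
    rewrite -(subrK c w); apply: idealD; [apply: Lv|exact: Lu];
    have := corrB corrR Rw uc; rewrite addrAC subrr add0r)
  ltac:(by move=> u v Lv w Rw; have [c uc] := corr_total corrR u;
    have [d vd] := corr_total corrR v;
    rewrite (Runiq Rw (corrM corrR uc vd)); apply: idealM; exact: Lv).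
move=> /(@ideal_powS_sub _ _ _ L); apply=> // u v Iu Iv w Rw.
have [c uc] := corr_total corrR u; have [d vd] := corr_total corrR v.
rewrite (Runiq Rw (corrM corrR uc vd)); apply: ideal_powM; last exact: IHk Iv.
exact/(RP.2 n _ _ (leqnn n) uc).
Qed.

Let pow_lift k b : ideal_pow J k b -> exists2 a, ideal_pow I k a & R a b.
Proof.
elim: k b => [|k IHk] b.
  by have [a ab] := corr_onto corrR b; exists a => //; apply: ideal_pow0.
pose L : ideal B := @Ideal _ [set b | exists2 a, ideal_pow I k.+1 a & R a b]
  ltac:(by exists 0; [exact: ideal0 | exact: corr0 corrR])
  ltac:(by move=> u v [a Ia au] [c Ic cv]; exists (a + c);
    [exact: idealD | exact: corrD corrR _ _ _ _ au cv])
  ltac:(by move=> u v [c Ic cv]; have [a au] := corr_onto corrR u;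
    exists (a * c); [exact: idealM | exact: corrM corrR _ _ _ _ au cv]).
apply: (@ideal_powS_sub _ _ _ L) => u v Ju /IHk[c Ic cv].
have [a au] := corr_onto corrR u; exists (a * c); last exact: (corrM corrR).
by apply: ideal_powM => //; apply/(RP.2 n _ _ (leqnn n) au).
Qed.

Let add_pow i k a b : (i <= n)%N -> R a b ->
  ideal_add (p i.+1) (ideal_pow I k) a <-> ideal_add (q i) (ideal_pow J k) b.
Proof.
move=> lin ab; split=> [[c pc Iac]|[d qd Jbd]].
  have [d cd] := corr_total corrR c; exists d; first exact/(RP.2 i _ _ lin cd).
  exact: pow_im (corrB corrR ab cd) Iac.
have [c cd] := corr_onto corrR d; have [e Ie ebd] := pow_lift Jbd.
exists (a - e); last by rewrite subKr.
apply/(RP.2 i _ _ lin (corrB corrR ab ebd)); by rewrite subKr.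
Qed.

Definition completion_rel (a : completion I) (b : completion J) :=
  exists u v, [/\ cauchy_rep a u, cauchy_rep b v & forall j, R (u j) (v j)].

(** The filtration of [B] is the image of that of [A] ([pow_im], [pow_lift]), and the extended
    ideals are closures, cut out by the conditions that [add_pow] compares. *)
Lemma completion_corr :
  chain_corr n (fun i => ideal_ext (to_completion I) (p i))
    (fun i => ideal_ext (to_completion J) (q i)) completion_rel.
Proof.
split; last first.
  move=> i a b lin [u [v [au bv uv]]].
  rewrite (ideal_ext_completion pcA) // (ideal_ext_completion pcB) //.
  rewrite (closed_extP _ au) (closed_extP _ bv).
  by split=> h k; have [N hN] := h k; exists N => j /hN /(add_pow _ lin (uv j)).
split.
- move=> a; have [u uf au] := cauchy_rep_fast a.
  have [f fR] := choice (corr_total corrR).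
  have vf : fast J (f \o u).
    by move=> k; apply: pow_im (uf k); apply: (corrB corrR); apply: fR.
  have [b bv] := fast_rep vf; exists b, u, (f \o u); split=> // j; exact: fR.
- move=> b; have [v vf bv] := cauchy_rep_fast b.
  have [f fR] := choice (corr_onto corrR).
  (* Lifting increment by increment, each inside the right power of [I], keeps the lifted sequence
     fast. *)
  have /choice[g gP] k : exists d, ideal_pow I k d /\ R d (v k.+1 - v k).
    by have [d Id dv] := pow_lift (vf k); exists d.
  pose u k := iteri k (fun k c => c + g k) (f (v 0%N)).
  have uv k : R (u k) (v k).
    elim: k => [|k IHk]; first exact: fR.
    by rewrite -(subrKC (v k) (v k.+1)); apply: (corrD corrR) IHk _;
      have [] := gP k.
  have uf : fast I u by move=> k; rewrite /u /= addrAC subrr add0r;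
    have [] := gP k.
  by have [a au] := fast_rep uf; exists a, u, v.
- exists (fun=> 1), (fun=> 1); split=> [||_]; last exact: (corr_one corrR).
    by rewrite -(rmorph1 (to_completion I)); apply: cauchy_rep_cst.
  by rewrite -(rmorph1 (to_completion J)); apply: cauchy_rep_cst.
- move=> a b a' b' [u [v [au bv uv]]] [u' [v' [au' bv' uv']]].
  exists (fun j => u j - u' j), (fun j => v j - v' j).
  by split=> [||j];
    [apply: cauchy_repB | apply: cauchy_repB | apply: (corrB corrR)].
- move=> a b a' b' [u [v [au bv uv]]] [u' [v' [au' bv' uv']]].
  exists (fun j => u j * u' j), (fun j => v j * v' j).
  by split=> [||j];
    [apply: cauchy_repM | apply: cauchy_repM | apply: (corrM corrR)].
Qed.

End CompletionCorr.

Section LocalizationCorr.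
Variables (n : nat) (A B : comPzRingType) (p : nat -> ideal A) (x : nat -> A).
Variables (q : nat -> ideal B) (y : nat -> B) (R : A -> B -> Prop).
Hypotheses (pcA : param_chain n.+2 p x) (pcB : param_chain n.+1 q y).
Hypothesis RP : chain_corr n.+1 p q R.
Let corrR := proj1 RP.
Let P := p n.+1.
Let Q := q n.

Definition localization_rel (f : localization (~` P)) (g : localization (~` Q))
  :=
  exists a s b t, [/\ ~ P s, ~ Q t & R s t] /\
    [/\ R a b, f * to_localization _ s = to_localization _ a
      & g * to_localization _ t = to_localization _ b].

Lemma localization_corr :
  chain_corr n (fun i => ideal_ext (to_localization (~` P)) (p i))
    (fun i => ideal_ext (to_localization (~` Q)) (q i)) localization_rel.
Proof.
have P_prime : prime_ideal P := pc_prime pcA (leqnSn _).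
have Q_prime : prime_ideal Q := pc_prime pcB (leqnSn _).
have PQ s t : R s t -> P s <-> Q t by apply: RP.2.
split; last first.
  move=> i f g lin [a [s [b [t [[Ps Qt st] [ab fE gE]]]]]].
  rewrite (ideal_ext_localization P_prime _ _ Ps fE); last first.
  - by apply: (chain_le (pc_succ pcA)); rewrite ltnS lin ltnW.
  - by apply: (pc_prime pcA); rewrite ltnS leqW.
  rewrite (ideal_ext_localization Q_prime _ _ Qt gE); last first.
  - by apply: (chain_le (pc_succ pcB)); rewrite lin leqnSn.
  - by apply: (pc_prime pcB); rewrite leqW.
  by apply: RP.2; rewrite // leqW.
split.
- move=> f; have [a [s Ps fE]] := prime_localization_frac P_prime f.
  have [b ab] := corr_total corrR a; have [t st] := corr_total corrR s.
  have Qt : ~ Q t by move/(PQ _ _ st).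
  have [g gE] := prime_localization_div Q_prime (to_localization _ b) Qt.
  by exists g, a, s, b, t.
- move=> g; have [b [t Qt gE]] := prime_localization_frac Q_prime g.
  have [a ab] := corr_onto corrR b; have [s st] := corr_onto corrR t.
  have Ps : ~ P s by move/(PQ _ _ st).
  have [f fE] := prime_localization_div P_prime (to_localization _ a) Ps.
  by exists f, a, s, b, t.
- exists 1, 1, 1, 1; have R1 := corr_one corrR; rewrite !mul1r.
  by split; split=> //; [apply: P_prime.1 | apply: Q_prime.1].
- move=> f g f' g' [a [s [b [t [[Ps Qt st] [ab fE gE]]]]]].
  move=> [a' [s' [b' [t' [[Ps' Qt' st'] [ab' fE' gE']]]]]].
  exists (a * s' - a' * s), (s * s'), (b * t' - b' * t), (t * t').
  split; split; try by [case/P_prime.2 | case/Q_prime.2];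
    try exact: (corrM corrR).
  + by apply: (corrB corrR); apply: (corrM corrR).
  + by rewrite rmorphB !rmorphM /= -fE -fE'; ring.
  + by rewrite rmorphB !rmorphM /= -gE -gE'; ring.
- move=> f g f' g' [a [s [b [t [[Ps Qt st] [ab fE gE]]]]]].
  move=> [a' [s' [b' [t' [[Ps' Qt' st'] [ab' fE' gE']]]]]].
  exists (a * a'), (s * s'), (b * b'), (t * t').
  split; split; try by [case/P_prime.2 | case/Q_prime.2];
    try exact: (corrM corrR).
  + by rewrite !rmorphM /= -fE -fE'; ring.
  + by rewrite !rmorphM /= -gE -gE'; ring.
Qed.

End LocalizationCorr.

(** * Uniqueness of the complete discrete valuation *)

Section Valuation.
Variable F : comPzRingType.
Hypothesis Ff : is_field F.
Implicit Types (x y z : F) (v w : discrete_valuation F).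

Let one_neq0 : (1 : F) <> 0. Proof. exact: Ff.1. Qed.

Lemma field_mul_neq0 x y : x <> 0 -> y <> 0 -> x * y <> 0.
Proof.
move=> x0 y0 xy; have [z yz] := Ff.2 y y0.
by apply: x0; rewrite -[x]mulr1 -yz mulrA xy mul0r.
Qed.

Lemma field_inv_neq0 x y : x * y = 1 -> y <> 0.
Proof. by move=> xy y0; apply: one_neq0; rewrite -xy y0 mulr0. Qed.

Lemma field_exp_neq0 x k : x <> 0 -> x ^+ k <> 0.
Proof.
move=> x0; elim: k => [|k IHk]; first by rewrite expr0.
by rewrite exprS; apply: field_mul_neq0.
Qed.

Lemma dval1 v : v 1 = 0.
Proof.
have := dvalM v one_neq0 one_neq0; rewrite mulr1 => v1.
by rewrite -[v 1](addrK (v 1)) -v1 subrr.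
Qed.

Lemma dvalV v x y : x <> 0 -> x * y = 1 -> v y = - v x.
Proof.
move=> x0 xy; apply/eqP; rewrite -addr_eq0 addrC -dvalM ?xy ?dval1 //.
exact: field_inv_neq0 xy.
Qed.

Lemma dvalX v x k : x <> 0 -> v (x ^+ k) = v x *+ k.
Proof.
move=> x0; elim: k => [|k IHk]; first by rewrite expr0 dval1.
by rewrite exprS dvalM ?IHk ?mulrS //; apply: field_exp_neq0.
Qed.

Lemma val_ge_neq0 v m x : x <> 0 -> val_ge v m x -> m <= v x.
Proof. by move=> x0 []. Qed.

Lemma val_ge_le v m k x : m <= k -> val_ge v k x -> val_ge v m x.
Proof. by move=> mk [|kx]; [left | right; apply: le_trans kx]. Qed.

Lemma val_ge0 v m : val_ge v m 0. Proof. by left. Qed.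

Lemma val_geB v m x y : val_ge v m x -> val_ge v m y -> val_ge v m (x - y).
Proof.
move=> mx my; apply: val_geD => //.
by rewrite -mulN1r -[m]add0r; apply: val_geM => //; apply: val_geN1.
Qed.

Lemma val_ge_mull v m x y : val_ge v 0 x -> val_ge v m y -> val_ge v m (x * y).
Proof. by rewrite -{2}[m]add0r; apply: val_geM. Qed.

Lemma val_ge_eq0 v x : (forall k : nat, val_ge v k%:Z x) -> x = 0.
Proof.
move=> xk; apply: contrapT => x0.
have := val_ge_neq0 x0 (xk (`|v x|.+1)%N); lia.
Qed.

Lemma not_val_ge1_1 v : ~ val_ge v 1 1.
Proof. by move=> /(val_ge_neq0 one_neq0); rewrite dval1. Qed.

Lemma complete_fast v (u : nat -> F) : complete_valuation v ->
  (forall k : nat, val_ge v k%:Z (u k.+1 - u k)) ->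
  exists l, forall k : nat, val_ge v k%:Z (u k - l).
Proof.
move=> vC uf.
have uB k j : (k <= j)%N -> val_ge v k%:Z (u j - u k).
  elim: j => [|j IHj]; first by rewrite leqn0 => /eqP ->; rewrite subrr; left.
  rewrite leq_eqVlt => /predU1P[->|kj]; first by rewrite subrr; left.
  have -> : u j.+1 - u k = u j.+1 - u j + (u j - u k) by ring.
  by apply: val_geD; [apply: val_ge_le (uf j); lia | apply: IHj].
have [m|l lP] := vC u.
  exists `|m|%N => i j mi mj; apply: (@val_ge_le _ _ `|m|%N); first lia.
  have -> : u i - u j = (u i - u `|m|%N) - (u j - u `|m|%N) by ring.
  by apply: val_geB; apply: uB.
exists l => k; have [N Nl] := lP k.
have -> : u k - l = (u (maxn k N) - l) - (u (maxn k N) - u k) by ring.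
by apply: val_geB; [apply/Nl/leq_maxr | apply/uB/leq_maxl].
Qed.

(** Fixed-point iteration: the difference quotient [d] of the nonlinear part has positive valuation
    on the maximal ideal, so the map is a contraction there. *)
Lemma hensel_cubic v a b t : complete_valuation v ->
  val_ge v 0 a -> val_ge v 0 b -> val_ge v 1 t ->
  exists2 z, val_ge v 1 z & z + a * z ^+ 2 + b * z ^+ 3 = t.
Proof.
move=> vC va vb vt.
pose u k := iteri k (fun _ z => t - a * z ^+ 2 - b * z ^+ 3) 0.
have u1 k : val_ge v 1 (u k).
  elim: k => [|k IHk]; first by left.
  have u0 : val_ge v 0 (u k) by apply: val_ge_le IHk.
  apply: val_geB; first apply: val_geB => //; apply: val_ge_mull => //;
    rewrite exprS;
    rewrite mulrC; apply: val_ge_mull => //.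
  by rewrite expr2; apply: val_ge_mull.
pose d y z := a * (y + z) + b * (y ^+ 2 + y * z + z ^+ 2).
have dP y z : val_ge v 1 y -> val_ge v 1 z -> val_ge v 1 (d y z).
  move=> y1 z1; have [y0 z0] : val_ge v 0 y /\ val_ge v 0 z by split;
    [apply: val_ge_le y1 | apply: val_ge_le z1].
  apply: val_geD; apply: val_ge_mull => //; first exact: val_geD.
  by do 2?apply: val_geD; rewrite ?expr2; apply: val_ge_mull.
have uf k : val_ge v k%:Z (u k.+1 - u k).
  elim: k => [|k IHk]; first by apply: val_geB;
    [apply: val_ge_le (u1 1%N) | left].
  have -> : u k.+2 - u k.+1 = (u k.+1 - u k) * (0 - d (u k.+1) (u k)).
    by rewrite /u /= -/(u k) /d; ring.
  have -> : k.+1%:Z = k%:Z + 1 by lia.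
  apply: val_geM => //; apply: val_geB; first by left.
  exact: dP.
have [l lP] := complete_fast vC uf; exists l.
  by rewrite -[l](subKr (u 1%N)); apply: val_geB => //; apply: (lP 1%N).
apply: subr0_eq; apply: (@val_ge_eq0 v) => k.
have -> : l + a * l ^+ 2 + b * l ^+ 3 - t =
    (0 - (u k.+1 - l)) + (u k - l) * (0 - d (u k) l).
  by rewrite /u /= -/(u k) /d; ring.
have l1 : val_ge v 1 l.
  by rewrite -[l](subKr (u 1%N)); apply: val_geB => //; apply: (lP 1%N).
apply: val_geD.
  by apply: val_geB; [left | apply: val_ge_le (lP k.+1); lia].
rewrite -[k%:Z]addr0; apply: val_geM => //; apply: val_geB; first by left.
by apply: val_ge_le (dP _ _ _ _).
Qed.

(** Square roots when 2 is a unit of the valuation ring; otherwise cube roots, 3 being a unit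
    because [3 - 2 = 1]. With the root written [1 + z], dividing by the unit [l] leaves an equation
    for [hensel_cubic]. *)
Lemma principal_unit_root v : complete_valuation v ->
  exists2 l, (1 < l)%N & forall y, val_ge v 1 (y - 1) ->
    exists2 z, val_ge v 1 (z - 1) & z ^+ l = y.
Proof.
move=> vC; have v1 := val_ge1 v.
have inv (c : F) : val_ge v 0 c -> ~ val_ge v 1 c ->
    exists2 h, val_ge v 0 h & c * h = 1.
  move=> c0 c1; have cn0 : c <> 0 by move=> c0'; apply: c1; rewrite c0'; left.
  have [h ch] := Ff.2 c cn0; exists h => //; right.
  rewrite (dvalV _ cn0 ch); have := val_ge_neq0 cn0 c0.
  suff : ~ (1 <= v c) by lia.
  by move=> vc; apply: c1; right.
have [v2|v2] := pselect (val_ge v 1 (1 + 1)).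
  have [||h h0 hE] := inv (1 + 1 + 1); first by do 2?apply: val_geD.
    by move=> v3; apply: (@not_val_ge1_1 v); have := val_geB v3 v2;
      rewrite addrAC subrr add0r.
  exists 3%N => // y vy.
  have [z z1 zE] := hensel_cubic vC v1 h0 (val_ge_mull h0 vy).
  exists (1 + z); first by rewrite addrAC subrr add0r.
  have -> : (1 + z) ^+ 3 = 1 + (1 + 1 + 1) * (z + 1 * z ^+ 2 + h * z ^+ 3)
      + (1 - (1 + 1 + 1) * h) * z ^+ 3 by ring.
  by rewrite zE mulrA hE subrr mul0r addr0 mul1r addrC subrK.
have [|//|h h0 hE] := inv (1 + 1); first exact: val_geD.
exists 2%N => // y vy.
have [z z1 zE] := hensel_cubic vC h0 (val_ge0 v 0) (val_ge_mull h0 vy).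
exists (1 + z); first by rewrite addrAC subrr add0r.
have -> : (1 + z) ^+ 2 = 1 + (1 + 1) * (z + h * z ^+ 2 + 0 * z ^+ 3)
    + (1 - (1 + 1) * h) * z ^+ 2 by ring.
by rewrite zE mulrA hE subrr mul0r addr0 mul1r addrC subrK.
Qed.

(* Principal units have arbitrarily high l-power roots, so any discrete       *)
(* valuation vanishes on them.                                                *)
Lemma dval_principal_unit v w y : complete_valuation v ->
  val_ge v 1 (y - 1) -> w y = 0.
Proof.
move=> /principal_unit_root[l l1 root].
have [k] := ubnP `|w y|%N; elim: k y => // k IHk y yk y1.
have [z z1 zy] := root y y1.
have z0 : z <> 0.
  by move=> z0; apply: (@not_val_ge1_1 v); have := val_geB (val_ge0 v 1) z1;
    rewrite z0 !sub0r opprK.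
have wE : w y = w z *+ l by rewrite -zy dvalX.
have [wz0|wz0] := eqVneq (w z) 0; first by rewrite wE wz0 mul0rn.
apply: contrapT => wy0; move/eqP: wz0; apply; apply: IHk z1.
rewrite wE -mulr_natr in wy0 yk *; nia.
Qed.

(** If [v y >= 1] then [1 + y] is a principal unit, so [w] vanishes on it and [y] is [w]-integral.
    Applied to [t * y ^+ k] for a [v]-uniformiser [t] and all [k], this puts the ring of [v] inside
    that of [w]. Then [w t > 0], and inversion gives the converse inclusions. *)
Lemma val_ge_uniq v w x : complete_valuation v ->
  (val_ge v 0 x <-> val_ge w 0 x) /\ (val_ge v 1 x <-> val_ge w 1 x).
Proof.
move=> vC.
have w_max y : val_ge v 1 y -> val_ge w 0 y.
  move=> y1; rewrite -[y](addKr 1); apply: val_geD; first exact: val_geN1.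
  by right; rewrite (@dval_principal_unit v) // addrAC subrr add0r.
have [t t0 vt] := dval_surj v 1.
have v_sub y : val_ge v 0 y -> val_ge w 0 y.
  have [->|/eqP y0] := eqVneq y 0; first by left.
  move=> /(val_ge_neq0 y0) vy; right.
  have ytn k : 0 <= w t + w y *+ k.
    have yk0 := @field_exp_neq0 y k y0.
    rewrite -dvalX // -dvalM //; apply: val_ge_neq0;
      first exact: field_mul_neq0.
    apply: w_max; right; rewrite dvalM // dvalX // vt.
    by rewrite lerDl mulrn_wge0.
  have := ytn `|w t|.+1; rewrite -mulr_natr; nia.
have w_neg y z : y <> 0 -> y * z = 1 -> v y <= 0 -> w y <= 0.
  move=> y0 yz vy; have z0 := field_inv_neq0 yz.
  have : val_ge w 0 z by apply: v_sub; right; rewrite (dvalV v y0 yz); lia.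
  by move=> /(val_ge_neq0 z0); rewrite (dvalV w y0 yz); lia.
(* An [s] with [w s = -1] cannot be [v]-integral. A power of [t] makes it a [v]-unit, hence
   [w]-integral, so that power has positive [w]. *)
have wt : 0 < w t.
  have [s s0 ws] := dval_surj w (-1).
  have vs : v s < 0.
    have : ~ val_ge v 0 s by move=> /v_sub/(val_ge_neq0 s0); rewrite ws.
    by case: (ltP (v s) 0) => // vs; case; right.
  have tn0 := @field_exp_neq0 t `|v s| t0.
  have vst : v (s * t ^+ `|v s|) = 0 by rewrite dvalM // dvalX // vt; lia.
  have st0 := field_mul_neq0 s0 tn0.
  have /(val_ge_neq0 st0) : val_ge w 0 (s * t ^+ `|v s|).
    by apply: v_sub; right; rewrite vst.
  rewrite dvalM // dvalX // ws -mulr_natr; nia.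
have [->|/eqP x0] := eqVneq x 0; first by split; split; left.
have [y xy] := Ff.2 x x0; have y0 := field_inv_neq0 xy.
have [r tr] := Ff.2 t t0; have r0 := field_inv_neq0 tr.
have v1w z : z <> 0 -> 1 <= v z -> 1 <= w z.
  move=> z0 vz; have zr0 := field_mul_neq0 z0 r0.
  have : val_ge w 0 (z * r).
    by apply: v_sub; right; rewrite dvalM // (dvalV v t0 tr) vt; lia.
  by move=> /(val_ge_neq0 zr0); rewrite dvalM // (dvalV w t0 tr); lia.
split; split=> [/(val_ge_neq0 x0) vx|/(val_ge_neq0 x0) wx]; right.
- by apply: val_ge_neq0 => //; apply: v_sub; right.
- case: (lerP 0 (v x)) => // vx.
  have : 1 <= w y by apply: v1w => //; rewrite (dvalV v x0 xy); lia.
  by rewrite (dvalV w x0 xy); lia.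
- exact: v1w.
- case: (lerP 1 (v x)) => // vx.
  by have := w_neg x y x0 xy; lia.
Qed.

End Valuation.

(** * Residue fields and ring isomorphisms *)

Lemma ring_iso_sym (A B : comPzRingType) : ring_iso A B -> ring_iso B A.
Proof.
move=> [f fbij]; have [g fK gK] := fbij.
apply: (@corr_iso _ _ (fun b a => f a = b)); first split.
- by move=> b; exists (g b).
- by move=> a; exists (f a).
- exact: rmorph1.
- by move=> _ a _ a' <- <-; rewrite rmorphB.
- by move=> _ a _ a' <- <-; rewrite rmorphM.
- move=> _ a <-; split=> [/eqP|->]; last exact: rmorph0.
  by rewrite -(rmorph0 f) => /eqP/(bij_inj fbij).
Qed.

Lemma ring_iso_trans (A B C : comPzRingType) :
  ring_iso A B -> ring_iso B C -> ring_iso A C.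
Proof.
move=> [f fbij] [g gbij]; exists (g \o f : {rmorphism A -> C}).
exact: bij_comp.
Qed.

(** The graph of a reduction map from the valuation ring onto [C] with kernel the maximal ideal; as
    a relation on [F] it moves easily between valuations and fields. *)
Record place (F C : comPzRingType) (v : discrete_valuation F)
    (R : F -> C -> Prop) : Prop := Place {
  place_dom : forall x, val_ge v 0 x -> exists c, R x c;
  place_int : forall x c, R x c -> val_ge v 0 x;
  place_onto : forall c, exists x, R x c;
  place_one : R 1 1;
  placeB : forall x c x' c', R x c -> R x' c' -> R (x - x') (c - c');
  placeM : forall x c x' c', R x c -> R x' c' -> R (x * x') (c * c');
  place_ker : forall x c, R x c -> val_ge v 1 x <-> c = 0 }.

Section Residue.
Variable F : comPzRingType.
Implicit Types (v w : discrete_valuation F) (C : comPzRingType).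

Lemma residue_place v : place v
  (fun x (r : valuation_residue v) =>
    exists2 o, valring_val o = x & quotient_map (valmax_ideal v) o = r).
Proof.
split.
- move=> x vx; have ox : in_valring v x by apply/asboolP.
  by exists (quotient_map (valmax_ideal v) (ValRing ox)), (ValRing ox).
- by move=> x r [o <- _]; apply/asboolP/valringP.
- by move=> r; have [o or] := quotient_map_surj r; exists (valring_val o), o.
- by exists 1; rewrite ?rmorph1.
- move=> _ _ _ _ [o <- <-] [o' <- <-]; exists (o - o') => //.
  by rewrite rmorphB.
- move=> _ _ _ _ [o <- <-] [o' <- <-]; exists (o * o') => //.
  by rewrite rmorphM.
- by move=> _ _ [o <- <-]; rewrite quotient_map_eq0.
Qed.

Lemma place_residue v C (R : F -> C -> Prop) :
  place v R -> ring_iso (valuation_residue v) C.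
Proof.
move=> Rp; have vp := residue_place v.
apply: (@corr_iso _ _ (fun r c => exists2 o, quotient_map (valmax_ideal v) o = r
  & R (valring_val o) c)); first split.
- move=> r; have [o or] := quotient_map_surj r.
  have [|c oc] := place_dom Rp (x := valring_val o);
    first exact/asboolP/valringP.
  by exists c, o.
- move=> c; have [x xc] := place_onto Rp c.
  have ox : in_valring v x by apply/asboolP/(place_int Rp xc).
  by exists (quotient_map (valmax_ideal v) (ValRing ox)), (ValRing ox).
- by exists 1; [rewrite rmorph1 | apply: (place_one Rp)].
- move=> _ c _ c' [o <- oc] [o' <- oc']; exists (o - o');
  first by rewrite rmorphB.
  exact: (placeB Rp).
- move=> _ c _ c' [o <- oc] [o' <- oc']; exists (o * o');
  first by rewrite rmorphM.
  exact: (placeM Rp).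
- by move=> _ c [o <- oc]; rewrite quotient_map_eq0 -(place_ker Rp oc).
Qed.

(** [residue] works with a complete valuation picked by [cid]; by [val_ge_uniq] it has the same ring
    and maximal ideal as [v], so [R] is a place for it too. *)
Lemma cdvf_residue v C (R : F -> C -> Prop) :
  is_field F -> complete_valuation v -> place v R ->
  cdvf F /\ ring_iso (residue F) C.
Proof.
move=> Ff vC Rp; have cF : cdvf F by split=> //; exists v.
split=> //; rewrite /residue; case: pselect => // FP.
move: (projT1 _) => w; apply: (@place_residue _ _ R).
have uniq x := val_ge_uniq Ff w x vC.
case: Rp => dom int onto one RB RM ker; split=> //.
- by move=> x /(uniq x).1 /dom.
- by move=> x c /int /(uniq x).1.
- by move=> x c xc; rewrite -(ker _ _ xc); apply: iff_sym; apply: (uniq x).2.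
Qed.

Lemma residue_spec : cdvf F -> exists v (R : F -> residue F -> Prop),
  complete_valuation v /\ place v R.
Proof.
move=> cF; rewrite /residue; case: pselect => // FP.
case: (cid _) => v vC /=; exists v; eexists; split=> //.
exact: residue_place.
Qed.

End Residue.

Lemma is_field_iso (F G : comPzRingType) : ring_iso F G -> is_field F ->
  is_field G.
Proof.
move=> [f [g fK gK]] [F1 Finv]; split=> [G1|y y0].
  by apply: F1; rewrite -[LHS]fK rmorph1 G1 -(rmorph0 f) fK.
have [|x xE] := Finv (g y).
  by move=> gy; apply: y0; rewrite -[y]gK gy rmorph0.
by exists (f x); rewrite -{1}[y]gK -rmorphM xE rmorph1.
Qed.

Lemma cdvf_iso (F G : comPzRingType) : ring_iso F G -> cdvf F ->
  cdvf G /\ ring_iso (residue F) (residue G).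
Proof.
move=> FG cF; have GF := ring_iso_sym FG.
have Gf := is_field_iso FG cF.1.
have [v [R [vC Rp]]] := residue_spec cF.
case: GF => g [f fK gK].
have g0 y : g y = 0 <-> y = 0.
  by split=> [gy|->]; [rewrite -[y]fK gy -(rmorph0 g) fK | rewrite rmorph0].
have g_neq0 y : y <> 0 -> g y <> 0 by move=> y0 /g0.
pose w := @DiscreteValuation G (fun y => v (g y))
  ltac:(by move=> x y x0 y0; rewrite /= rmorphM dvalM //; apply: g_neq0)
  ltac:(by move=> x y x0 y0 xy0; rewrite /= rmorphD; apply: dvalD;
        rewrite -?rmorphD; apply: g_neq0)
  ltac:(by move=> m; have [x x0 vx] := dval_surj v m; exists (f x);
    [move=> /g0; rewrite gK | rewrite gK]).
have wE m y : val_ge w m y <-> val_ge v m (g y).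
  by split=> -[y0|my]; [left; apply/g0 | right | left; apply/g0 | right].
have wC : complete_valuation w.
  move=> u uC; have [m|l lP] := vC (g \o u).
    have [N uN] := uC m; exists N => i j iN jN /=.
    by rewrite -rmorphB; apply/wE/uN.
  exists (f l) => m; have [N Nl] := lP m; exists N => i /Nl /=.
  by rewrite -{1}[l]gK -rmorphB => /wE.
have [|cG GR] := @cdvf_residue G w (residue F) (fun y r => R (g y) r) Gf wC.
  split.
  - by move=> y /wE /(place_dom Rp).
  - by move=> y r /(place_int Rp) /wE.
  - by move=> r; have [x xr] := place_onto Rp r; exists (f x); rewrite gK.
  - by rewrite rmorph1; apply: (place_one Rp).
  - by move=> y r y' r'; rewrite rmorphB; apply: (placeB Rp).
  - by move=> y r y' r'; rewrite rmorphM; apply: (placeM Rp).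
  - by move=> y r yr; rewrite wE; apply: (place_ker Rp).
by split=> //; apply: ring_iso_sym.
Qed.

Lemma cdvdim_geP F n :
  cdvdim_ge F n <-> forall i, (i < n)%N -> cdvf (residue_field i F).
Proof.
rewrite /cdvdim_ge /cdvdim; case: pselect => [FP|nFP]; last first.
  by split=> // _ i _; apply: contrapT => nc; apply: nFP; exists i;
    apply/asboolPn.
case: ex_minnP => d /asboolPn nd dmin; split=> [nd' i lin|h].
  apply: contrapT => /asboolPn/dmin; lia.
by rewrite leqNgt; apply/negP => /h.
Qed.

Lemma residue_field_iso F G i : ring_iso F G ->
  (forall j, (j < i)%N -> cdvf (residue_field j G)) ->
  ring_iso (residue_field i F) (residue_field i G).
Proof.
move=> FG; elim: i => [|i IHi] Gc //=.
have FGi := IHi (fun j ji => Gc j (leqW ji)).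
have [_ h] := cdvf_iso (ring_iso_sym FGi) (Gc i (leqnn _)).
exact: ring_iso_sym.
Qed.

Lemma cdvdim_ge_succ F G n : cdvf F -> ring_iso (residue F) G ->
  cdvdim_ge G n ->
  cdvdim_ge F n.+1 /\ ring_iso (residue_field n.+1 F) (residue_field n G).
Proof.
move=> cF FG /cdvdim_geP Gc; rewrite residue_fieldS.
split; last exact: residue_field_iso.
apply/cdvdim_geP => -[|i] // lin; rewrite residue_fieldS.
have iso : ring_iso (residue_field i (residue F)) (residue_field i G).
  by apply: residue_field_iso => // j ji; apply: Gc; apply: ltn_trans ji _.
by have [] := cdvf_iso (ring_iso_sym iso) (Gc i lin).
Qed.

(** * Fractions of a complete discrete valuation ring *)

Section FractionValuation.
Variables (D : comPzRingType) (Q : ideal D) (pi : D).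
Hypothesis Q_prime : prime_ideal Q.
Hypothesis Q0 : forall d, Q d -> d = 0.
Hypothesis pi_neq0 : pi <> 0.
Hypothesis pi_nonunit : forall c, pi * c <> 1.
Hypothesis pi_factor : forall d, d <> 0 ->
  exists k w, (exists w', w * w' = 1) /\ d = pi ^+ k * w.
Hypothesis pi_complete : forall u : nat -> D,
  (forall k, exists c, u k.+1 - u k = pi ^+ k * c) ->
  exists l, forall k, exists c, u k - l = pi ^+ k * c.
Local Notation F := (localization (~` Q)).
Local Notation toF := (to_localization (~` Q)).

Let one_neq0 : (1 : D) <> 0.
Proof. by move=> e; apply: Q_prime.1; rewrite e; apply: ideal0. Qed.

Let mul_neq0 (a b : D) : a <> 0 -> b <> 0 -> a * b <> 0.
Proof.
move=> a0 b0 ab; have : Q (a * b) by rewrite ab; apply: ideal0.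
by move=> /(Q_prime.2)[/Q0|/Q0].
Qed.

Let mul_cancel (a b c : D) : a <> 0 -> a * b = a * c -> b = c.
Proof.
move=> a0 abc; apply: subr0_eq; apply: contrapT => bc.
by apply: (mul_neq0 a0 bc); rewrite mulrBr abc subrr.
Qed.

Let exp_neq0 k : pi ^+ k <> 0.
Proof.
elim: k => [|k IHk]; first by rewrite expr0.
by rewrite exprS; apply: mul_neq0.
Qed.

Let neq0_notin (a : D) : a <> 0 -> ~ Q a. Proof. by move=> a0 /Q0. Qed.

Let notin_neq0 (a : D) : ~ Q a -> a <> 0.
Proof. by move=> Qa a0; apply: Qa; rewrite a0; apply: ideal0. Qed.

Let unit_exp k w w' c : w * w' = 1 -> w = pi ^+ k * c -> k = 0%N.
Proof.
case: k => // k ww' wE; case: (@pi_nonunit (pi ^+ k * c * w')).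
by rewrite -ww' wE exprS; ring.
Qed.

(** The condition [d <> 0] sits under the existential so that [cid] yields a total [ord]. *)
Let ord_ex d : exists k, d <> 0 -> exists2 w, exists w',
  w * w' = 1 & d = pi ^+ k * w.
Proof.
have [->|/eqP d0] := eqVneq d 0; first by exists 0%N.
by have [k [w [wu dE]]] := pi_factor d0; exists k => _; exists w.
Qed.

Let ord d := sval (cid (ord_ex d)).

Let ordP d : d <> 0 -> exists2 w, exists w', w * w' = 1 & d = pi ^+ (ord d) * w.
Proof. by rewrite /ord; case: (cid _). Qed.

Let ord_uniq d k w w' : w * w' = 1 -> d = pi ^+ k * w -> ord d = k.
Proof.
move=> ww' dE.
have w0 : w <> 0 by move=> w0; apply: one_neq0; rewrite -ww' w0 mul0r.
have d0 : d <> 0 by rewrite dE; apply: mul_neq0.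
have [z [z' zz'] dE'] := ordP d0.
have [le|/ltnW le] := leqP k (ord d).
  have : w = pi ^+ (ord d - k) * z.
    by apply: (mul_cancel (@exp_neq0 k)); rewrite mulrA -exprD subnKC // -dE.
  by move=> /(unit_exp ww'); lia.
have : z = pi ^+ (k - ord d) * w.
  by apply: (mul_cancel (@exp_neq0 (ord d)));
    rewrite mulrA -exprD subnKC // -dE'.
by move=> /(unit_exp zz'); lia.
Qed.

Let ordM a b : a <> 0 -> b <> 0 -> ord (a * b) = (ord a + ord b)%N.
Proof.
move=> /ordP[w [w' ww'] aE] /ordP[z [z' zz'] bE].
apply: (@ord_uniq _ _ (w * z) (w' * z')).
  by rewrite mulrACA ww' zz' mulr1.
by rewrite {1}aE {1}bE exprD; ring.
Qed.

Let ord_exp k : ord (pi ^+ k) = k.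
Proof. by apply: (@ord_uniq _ _ 1 1); rewrite mulr1. Qed.

Let ord1 : ord 1 = 0%N. Proof. exact: (ord_exp 0). Qed.

Let ord_dvd d k : d <> 0 -> (k <= ord d)%N <-> exists c, d = pi ^+ k * c.
Proof.
move=> d0; split=> [kd|[c dE]].
  have [w _ dE] := ordP d0; exists (pi ^+ (ord d - k) * w).
  by rewrite mulrA -exprD subnKC.
have c0 : c <> 0 by move=> c0; apply: d0; rewrite dE c0 mulr0.
by rewrite dE ordM // ord_exp leq_addr.
Qed.

Let ordD a b : a <> 0 -> b <> 0 -> a + b <> 0 ->
  (minn (ord a) (ord b) <= ord (a + b))%N.
Proof.
move=> a0 b0 ab0; apply/(ord_dvd _ ab0).
have [c aE] : exists c, a = pi ^+ minn (ord a) (ord b) * c by apply/ord_dvd;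
  rewrite ?geq_minl.
have [d bE] : exists d, b = pi ^+ minn (ord a) (ord b) * d by apply/ord_dvd;
  rewrite ?geq_minr.
by exists (c + d); rewrite mulrDr -aE -bE.
Qed.

Let toF_eq0 a : toF a = 0 -> a = 0.
Proof.
move=> /(prime_to_localization_eq0 Q_prime)[u Qu ua]; apply: contrapT => a0.
exact: mul_neq0 (notin_neq0 Qu) a0 ua.
Qed.

Let toF_inj a b : toF a = toF b -> a = b.
Proof. by move=> ab; apply/subr0_eq/toF_eq0; rewrite rmorphB /= ab subrr. Qed.

Definition is_ratio (f : F) (a s : D) := s <> 0 /\ f * toF s = toF a.

Let ratio_ex (f : F) : exists as_ : D * D, is_ratio f as_.1 as_.2.
Proof.
have [a [s Qs fE]] := prime_localization_frac Q_prime f.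
by exists (a, s); split=> //; apply: notin_neq0.
Qed.

Let ratio_eq0 f a s : is_ratio f a s -> f = 0 <-> a = 0.
Proof.
move=> [s0 fE]; split=> [f0|a0].
  by apply: toF_eq0; rewrite -fE f0 mul0r.
have [r rs] := prime_localization_div Q_prime 1 (neq0_notin s0).
by rewrite -[f]mulr1 -rs mulrCA fE a0 rmorph0 mulr0.
Qed.

Let ratio_cancel f s g : s <> 0 -> f * toF s = g * toF s -> f = g.
Proof.
move=> s0 fg; have [r rs] := prime_localization_div Q_prime 1 (neq0_notin s0).
by rewrite -[f]mulr1 -rs mulrCA fg mulrCA rs mulr1.
Qed.

Let ratio_toF a : is_ratio (toF a) a 1.
Proof. by split=> //; rewrite rmorph1 mulr1. Qed.

Let value f : int :=
  let: (a, s) := sval (cid (ratio_ex f)) in (ord a)%:Z - (ord s)%:Z.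

Let valueE f a s : f <> 0 -> is_ratio f a s ->
  value f = (ord a)%:Z - (ord s)%:Z.
Proof.
move=> f0 fr; rewrite /value; case: (cid _) => -[b t] /= fr'.
have a0 : a <> 0 by move/(ratio_eq0 fr).
have b0 : b <> 0 by move/(ratio_eq0 fr').
have [[s0 fa] [t0 fb]] := (fr, fr').
have : a * t = b * s.
  by apply: toF_inj; rewrite !rmorphM /= -fa -fb; ring.
by move=> /(congr1 ord); rewrite !ordM //; lia.
Qed.

Let valueM f g : f <> 0 -> g <> 0 -> value (f * g) = value f + value g.
Proof.
move=> f0 g0; have [[a s] /= fr] := ratio_ex f;
  have [[b t] /= gr] := ratio_ex g.
have a0 : a <> 0 by move/(ratio_eq0 fr).
have b0 : b <> 0 by move/(ratio_eq0 gr).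
have [[s0 fE] [t0 gE]] := (fr, gr).
have fgr : is_ratio (f * g) (a * b) (s * t).
  by split; [apply: mul_neq0 | rewrite !rmorphM /= -fE -gE; ring].
have fg0 : f * g <> 0 by move=> /(ratio_eq0 fgr); apply: mul_neq0.
by rewrite (valueE fg0 fgr) (valueE f0 fr) (valueE g0 gr) !ordM //; lia.
Qed.

Let valueD f g : f <> 0 -> g <> 0 -> f + g <> 0 ->
  Order.min (value f) (value g) <= value (f + g).
Proof.
move=> f0 g0 fg0; have [[a s] /= fr] := ratio_ex f;
  have [[b t] /= gr] := ratio_ex g.
have a0 : a <> 0 by move/(ratio_eq0 fr).
have b0 : b <> 0 by move/(ratio_eq0 gr).
have [[s0 fE] [t0 gE]] := (fr, gr).
have fgr : is_ratio (f + g) (a * t + b * s) (s * t).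
  by split; [apply: mul_neq0 | rewrite rmorphD !rmorphM /= -fE -gE; ring].
have ab0 : a * t + b * s <> 0 by move=> /(ratio_eq0 fgr).
rewrite (valueE fg0 fgr) (valueE f0 fr) (valueE g0 gr).
have := ordD (mul_neq0 a0 t0) (mul_neq0 b0 s0) ab0.
rewrite !ordM // ge_min.
move: (ord (a * t + b * s)) (ord a) (ord b) (ord s) (ord t) => m i j k l;
  rewrite geq_min; lia.
Qed.

Let value_surj m : exists2 f : F, f <> 0 & value f = m.
Proof.
have exp_ratio k f : is_ratio f (pi ^+ k) 1 -> f <> 0.
  by move=> fr /(ratio_eq0 fr); apply: exp_neq0.
case: m => k.
  have fr := ratio_toF (pi ^+ k).
  have f0 : toF (pi ^+ k) <> 0 by move/toF_eq0; apply: exp_neq0.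
  by exists (toF (pi ^+ k)); rewrite ?(valueE f0 fr) ?ord_exp ?ord1 ?subr0.
have [f fE] := prime_localization_div Q_prime 1 (neq0_notin (@exp_neq0 k.+1)).
have fr : is_ratio f 1 (pi ^+ k.+1) by split; rewrite ?fE ?rmorph1.
have f0 : f <> 0 by move/(ratio_eq0 fr).
by exists f; rewrite // (valueE f0 fr) ord_exp ord1; lia.
Qed.

Definition fraction_valuation : discrete_valuation F :=
  DiscreteValuation valueM valueD value_surj.
Local Notation v := fraction_valuation.

Lemma fraction_val_ge k d :
  val_ge v k%:Z (toF d) <-> exists c, d = pi ^+ k * c.
Proof.
have [->|/eqP d0] := eqVneq d 0.
  by split=> [_|_]; [exists 0; rewrite mulr0 | left; rewrite rmorph0].
have f0 : toF d <> 0 by move/toF_eq0.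
rewrite -(ord_dvd _ d0) /val_ge /= (valueE f0 (ratio_toF d)) ord1 subr0 lez_nat.
by split=> [[|]|] //; right.
Qed.

Lemma fraction_val_int f : val_ge v 0 f <-> exists d, f = toF d.
Proof.
split=> [|[d ->]]; last by apply/(fraction_val_ge 0); exists d;
  rewrite expr0 mul1r.
have [[a s] /= fr] := ratio_ex f.
have [->|/eqP f0] := eqVneq f 0; first by exists 0; rewrite rmorph0.
case=> //; rewrite /= (valueE f0 fr) => sa;
  have {}sa : (ord s <= ord a)%N by lia.
have a0 : a <> 0 by move/(ratio_eq0 fr).
have [s0 fE] := fr.
have /(ord_dvd _ a0)[c aE] := sa; have [w [w' ww'] sE] := ordP s0.
exists (c * w'); apply: (ratio_cancel s0); rewrite fE -rmorphM; congr toF.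
have -> : c * w' * s = c * w' * (pi ^+ ord s * w) by rewrite -sE.
by rewrite {1}aE -[LHS]mulr1 -ww'; ring.
Qed.

(** Along the subsequence [M], the differences from the term at [M 0] are integral, hence come from
    [D], where they converge by [pi_complete]. *)
Lemma fraction_complete : complete_valuation v.
Proof.
move=> u uC; have /choice[N uN] : forall k : nat, exists N, forall i j,
  (N <= i)%N -> (N <= j)%N -> val_ge v k%:Z (u i - u j) by move=> k; apply: uC.
pose M k := (\max_(j < k.+1) N j)%N.
have NM k j : (k <= j)%N -> (N k <= M j)%N.
  by rewrite -ltnS => kj; apply: (leq_bigmax (Ordinal kj)).
have /choice[d dE] : forall k, exists d, u (M k) - u (M 0%N) = toF d.
  by move=> k; apply/fraction_val_int/(uN 0%N); apply: NM.
have [k|l lP] := pi_complete (u := d).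
  apply/fraction_val_ge; rewrite rmorphB /= -!dE.
  have -> : u (M k.+1) - u (M 0%N) - (u (M k) - u (M 0%N)) = u (M k.+1)
    - u (M k).
    by ring.
  by apply: uN; apply: NM; rewrite // leqnSn.
exists (u (M 0%N) + toF l) => m; exists (M `|m|%N) => i Mi.
apply: (@val_ge_le _ _ _ `|m|%N); first lia.
have -> : u i - (u (M 0%N) + toF l) = (u i - u (M `|m|%N)) + toF (d `|m|%N - l).
  by rewrite rmorphB /= -dE; ring.
apply: val_geD; last exact/fraction_val_ge.
apply: uN; last exact: NM.
by apply: leq_trans Mi; apply: NM.
Qed.

End FractionValuation.

Lemma param_chain0_field (A : comPzRingType) (p : nat -> ideal A) (x : nat ->
  A) :
  param_chain 0 p x -> is_field A /\ p 0%N = [set 0] :> set A.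
Proof.
move=> pc; have p0 a : p 0%N a -> a = 0 := pc_zero pc (a := a).
split; last by apply/seteqP; split=> [a /p0 //|_ ->]; apply: ideal0.
split=> [e|a a0].
  by apply: (pc_prime pc (leqnn 0)).1; rewrite e; apply: ideal0.
have [|b /p0/subr0_eq ba] := pc_field pc (a := a); first by move/p0.
by exists b; rewrite mulrC.
Qed.

(** * Completing a chain of length one *)

Section DiscreteValuationRing.
Variables (A : comPzRingType) (p : nat -> ideal A) (x : nat -> A).
Hypothesis pc : param_chain 1 p x.
Let I := p 1.
Local Notation D := (completion I).
Local Notation toD := (to_completion I).
Let pi : D := toD (x 0%N).
Let P i := ideal_ext toD (p i).

Let pcD : param_chain 1 P (toD \o x).
Proof. exact: (completion_param_chain pc). Qed.

Let p0 a : p 0%N a -> a = 0. Proof. exact: (pc_zero pc). Qed.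

Let x_cancel k a : x 0%N ^+ k * a = 0 -> a = 0.
Proof.
elim: k => [|k IHk]; first by rewrite mul1r.
rewrite exprS -mulrA => xa; apply/IHk/p0/(param_chain_reg pc (i := 0)) => //.
by rewrite xa; apply: ideal0.
Qed.

Let I_x a : I a <-> exists b, a = x 0%N * b.
Proof.
rewrite /I (pc_succ pc) //; split=> [[b /p0/subr0_eq ->]|[b ->]].
  by exists b; rewrite mulrC.
by rewrite mulrC; apply/idealM/adjoinr.
Qed.

Let pow_x k a : ideal_pow I k a <-> exists b, a = x 0%N ^+ k * b.
Proof.
elim: k a => [|k IHk] a.
  by split=> [_|_]; [exists a; rewrite mul1r | apply: ideal_pow0].
split=> [|[b ->]].
  pose J := adjoin (zero_ideal A) (x 0%N ^+ k.+1).
  have /[apply] : ideal_pow I k.+1 `<=` J.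
    apply: ideal_powS_sub => _ _ /I_x[b ->] /IHk[c ->]; exists (b * c) => /=.
    by rewrite exprS; ring.
  by move=> [b /= /subr0_eq ->]; exists b; rewrite mulrC.
rewrite exprS -mulrA; apply: ideal_powM; last by apply/IHk; exists b.
by apply/I_x; exists 1; rewrite mulr1.
Qed.

(** If the terms from index [k] on are multiples of [x 0%N ^+ k], a nonzerodivisor generating the
    k-th power of [I], they can be divided termwise; the quotients, reindexed by [k], are again
    fast. *)
Let pi_dvd k al u : fast I u -> cauchy_rep al u ->
  ideal_pow I k (u k) <-> exists c, al = pi ^+ k * c.
Proof.
move=> uf au; split=> [uk|[c ac]].
  have /choice[a aE] : forall j, exists a, u (k + j)%N = x 0%N ^+ k * a.
    move=> j; apply/pow_x; rewrite -[u _](subrK (u k)).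
    by apply: idealD => //; apply: fastB; rewrite // leq_addr.
  have af : fast I a.
    move=> j; apply/pow_x; have /pow_x[b bE] := uf (k + j)%N.
    exists b; apply/subr0_eq/(x_cancel (k := k)).
    have -> : x 0%N ^+ k * (a j.+1 - a j - x 0%N ^+ j * b) =
       x 0%N ^+ k * a j.+1 - x 0%N ^+ k * a j - x 0%N ^+ (k + j)
         * b by rewrite exprD; ring.
    by rewrite -bE -!aE addnS subrr.
  have [c ca] := fast_rep af; exists c.
  have xk : cauchy_rep (pi ^+ k) (fun=> x 0%N ^+ k).
    by rewrite -rmorphXn; apply: cauchy_rep_cst.
  apply: cauchy_rep_eq au (cauchy_repM xk ca) _ => l; exists l => j lj.
  rewrite -aE -opprB; apply: idealN.
  by apply: ideal_pow_le lj _ _; apply: fastB; rewrite // leq_addl.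
have [v vf cv] := cauchy_rep_fast c.
have xk : cauchy_rep (pi ^+ k) (fun=> x 0%N ^+ k).
  by rewrite -rmorphXn; apply: cauchy_rep_cst.
have /cauchy_rep_eq0[+ _] := cauchy_repB au (cauchy_repM xk cv).
rewrite ac subrr => /(_ erefl k)[N uN]; set m := maxn N k.
rewrite -[u k](subKr (u m)); apply: idealB; last first.
  by apply: fastB; rewrite // leq_maxr.
apply: ideal_sub (uN m (leq_maxl _ _)) _.
by apply/pow_x; exists (v m).
Qed.

Let pi_separated al : (forall k, exists c, al = pi ^+ k * c) -> al = 0.
Proof.
move=> aP; have [u uf au] := cauchy_rep_fast al.
apply: (@closed_ext0 _ _ (p 0%N)) => //; apply/(closed_ext_fast _ uf au) => k.
by apply/ideal_addr/(pi_dvd _ uf au).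
Qed.

(** Diagonal argument: replace each [u k] by an element of [A] congruent to it modulo [pi ^+ k];
    these elements form a fast sequence, whose class is the limit. *)
Let pi_complete (u : nat -> D) : (forall k, exists c,
  u k.+1 - u k = pi ^+ k * c) ->
  exists l, forall k, exists c, u k - l = pi ^+ k * c.
Proof.
move=> uf.
have /choice[a aE] : forall k, exists a, exists c, u k - toD a = pi ^+ k * c.
  move=> k; have [w wf uw] := cauchy_rep_fast (u k); exists (w k).
  have wf' : fast I (fun j => w j - w k).
    by move=> j; rewrite opprB addrA subrK; apply: wf.
  apply/(pi_dvd k wf' (cauchy_repB uw (cauchy_rep_cst I (w k)))).
  by rewrite subrr; apply: ideal0.
have af : fast I a.
  move=> k; have cf : fast I (fun=> a k.+1 - a k).
    by move=> j; rewrite subrr; apply: ideal0.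
  apply/(pi_dvd k cf (cauchy_rep_cst I _)); rewrite rmorphB /=.
  have [[[c cE] [d dE]] [e eE]] := (aE k, aE k.+1, uf k).
  exists (e + c - pi * d).
  have -> : pi ^+ k * (e + c - pi * d)
    = pi ^+ k * e + pi ^+ k * c - pi ^+ k.+1 * d.
    by rewrite exprS; ring.
  by rewrite -cE -dE -eE; ring.
have [l la] := fast_rep af; exists l => k.
have [c cE] := aE k.
have [d dE] : exists d, toD (a k) - l = pi ^+ k * d.
  have af' : fast I (fun j => a k - a j).
    move=> j; have -> : a k - a j.+1 - (a k - a j) = - (a j.+1 - a j) by ring.
    exact: idealN.
  apply/(pi_dvd k af' (cauchy_repB (cauchy_rep_cst I (a k)) la)).
  by rewrite subrr; apply: ideal0.
by exists (c + d); rewrite mulrDr -cE -dE; ring.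
Qed.

Let P1_pi al : P 1 al <-> exists c, al = pi * c.
Proof.
rewrite (pc_succ pcD) //; split=> [[c /(pc_zero pcD)/subr0_eq ->]|[c ->]].
  by exists c; rewrite mulrC.
by rewrite mulrC; apply/idealM/adjoinr.
Qed.

(** The inverse is the sum of the geometric series in [pi * c]. *)
Let principal_unit c : exists g, (1 - pi * c) * g = 1.
Proof.
pose s k := iteri k (fun i r => r + (pi * c) ^+ i) 0.
have sE k : (1 - pi * c) * s k = 1 - (pi * c) ^+ k.
  elim: k => [|k IHk]; first by rewrite mulr0 expr0 subrr.
  by rewrite /s /= -/(s k) mulrDr IHk exprS; ring.
have [|l lP] := pi_complete (u := s).
  move=> k; exists (c ^+ k); rewrite -exprMn /s /= addrAC subrr add0r //.
exists l; apply/subr0_eq/pi_separated => k; have [d dE] := lP k.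
exists (- (1 - pi * c) * d - c ^+ k).
have -> : (1 - pi * c) * l - 1 = (1 - pi * c) * s k - 1 - (1 - pi * c)
  * (s k - l) by ring.
by rewrite sE dE exprMn; ring.
Qed.

Let P_unit al : ~ P 1 al -> exists g, al * g = 1.
Proof.
move=> /(pc_field pcD)[b /P1_pi[c cE]].
have [g gE] := principal_unit (- c); exists (b * g).
rewrite -gE mulrA; congr (_ * _).
by rewrite mulrN opprK -cE mulrC; ring.
Qed.

Let pi_factor al : al <> 0 ->
  exists k w, (exists w', w * w' = 1) /\ al = pi ^+ k * w.
Proof.
move=> a0; have [u uf au] := cauchy_rep_fast al.
(* [k] is the order of [al], finite because an element divisible by all powers of [pi] is zero. *)
have [k [uk nuk]] : exists k, ideal_pow I k (u k)
  /\ ~ ideal_pow I k.+1 (u k.+1).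
  apply: contrapT => nk; apply: a0; apply: pi_separated => k.
  apply/(pi_dvd _ uf au); elim: k => [|k IHk]; first exact: ideal_pow0.
  by apply: contrapT => nuk; apply: nk; exists k.
have [w wE] := (pi_dvd k uf au).1 uk; exists k, w; split=> //.
apply: P_unit => /P1_pi[c cE]; apply: nuk; apply/(pi_dvd _ uf au).
by exists c; rewrite wE cE exprS; ring.
Qed.

Variables (B : comPzRingType) (q : nat -> ideal B) (y : nat -> B).
Variable R : A -> B -> Prop.
Hypotheses (pcB : param_chain 0 q y) (RP : chain_corr 0 p q R).

(** An integral fraction is an element of the completion, hence congruent modulo [P 1] to some [a]
    of [A]; its residue is the element of [B] related to [a]. *)
Lemma completion_fraction_residue :
  cdvf (localization (~` P 0%N))
    /\ ring_iso (residue (localization (~` P 0%N))) B.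
Proof.
have P0_prime : prime_ideal (P 0%N) := pc_prime pcD (leq0n 1).
have P0 : forall d, P 0%N d -> d = 0 := pc_zero pcD.
have pi0 : pi <> 0.
  move=> pi0; apply: (pc_notin pcD (ltn0Sn 0)).
  have -> : (toD \o x) 0%N = 0 by exact: pi0.
  exact: ideal0.
have pi1 c : pi * c <> 1.
  move=> c1; apply: (pc_prime pcD (leqnn 1)).1.
  by apply/P1_pi; exists c.
pose v := fraction_valuation P0_prime P0 pi0 pi1 pi_factor.
have vC : complete_valuation v by apply: fraction_complete; apply: pi_complete.
have v_int f : val_ge v 0 f <-> exists d, f = to_localization _ d.
  exact: fraction_val_int.
have v_max d : val_ge v 1 (to_localization _ d) <-> P 1 d.
  by rewrite (fraction_val_ge _ _ _ _ _ 1) expr1 P1_pi.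
have toP a : P 1 (toD a) <-> p 1 a.
  rewrite /P (ideal_ext_completion pc) //.
  rewrite closed_ext_cst; split=> [/(_ 1%N)[b pb /ideal_pow1 Iab]|pa k].
    exact: ideal_sub Iab pb.
  exact: ideal_addl.
have qE a b : R a b -> p 1 a <-> b = 0.
  move=> ab; rewrite (RP.2 0%N a b (leqnn 0) ab);
    split=> [/(pc_zero pcB) //|->].
  exact: ideal0.
have Ff : is_field (localization (~` P 0%N)).
  exact: (param_chain0_field (localization_param_chain pcD)).1.
apply: (@cdvf_residue _ v B (fun f b => exists d a,
  [/\ f = to_localization _ d, P 1 (d - toD a) & R a b])) => //.
split.
- move=> f /v_int[d ->]; have [u uf du] := cauchy_rep_fast d.
  have [b ab] := corr_total RP.1 (u 1%N); exists b, d, (u 1%N); split=> //.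
  rewrite /P (ideal_ext_completion pc) //.
  exists (fun j => u j - u 1%N); first exact: cauchy_repB (cauchy_rep_cst _ _).
  move=> k; exists 1%N => j j0; apply/ideal_addl/ideal_pow1.
  exact: fastB.
- by move=> f b [d [a [-> _ _]]]; apply/v_int; exists d.
- move=> b; have [a ab] := corr_onto RP.1 b.
  exists (to_localization _ (toD a)), (toD a), a; split=> //.
  by rewrite subrr; apply: ideal0.
- exists 1, 1; split; rewrite ?rmorph1 ?subrr //; first exact: ideal0.
  exact: (corr_one RP.1).
- move=> _ b _ b' [d [a [-> da ab]]] [d' [a' [-> da' ab']]].
  exists (d - d'), (a - a'); split; rewrite ?rmorphB //;
    last exact: (corrB RP.1).
  have -> : d - d' - (toD a - toD a') = (d - toD a) - (d' - toD a') by ring.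
  exact: idealB.
- move=> _ b _ b' [d [a [-> da ab]]] [d' [a' [-> da' ab']]].
  exists (d * d'), (a * a'); split; rewrite ?rmorphM //;
    last exact: (corrM RP.1).
  have -> : d * d' - toD a * toD a' = d' * (d - toD a) + toD a * (d' - toD a')
    by ring.
  by apply: idealD; apply: idealM.
- move=> _ b [d [a [-> da ab]]]; rewrite v_max -(qE _ _ ab) -toP; split=> h.
    by rewrite -[toD a](subKr d); apply: idealB.
  exact: ideal_sub da h.
Qed.

End DiscreteValuationRing.

(** * Iterated completion and localisation *)

Lemma param_chain_ext (A : comPzRingType) n (p p' : nat -> ideal A) x :
  (forall i, (i <= n)%N -> p i = p' i) -> param_chain n p x ->
    param_chain n p' x.
Proof.
move=> e pc; split.
- by move=> a; rewrite -e //; apply: (pc_zero pc).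
- by move=> i lin; rewrite -!e ?(ltnW lin) //; apply: (pc_succ pc).
- by move=> i lin; rewrite -e //; apply: (pc_prime pc).
- by move=> i lin; rewrite -e ?(ltnW lin) //; apply: (pc_notin pc).
- by move=> a; rewrite -e //; apply: (pc_field pc).
Qed.

Lemma chain_nat_max n (A : ring_chain n)
  : chain_ideal A ord_max = chain_nat A n.
Proof. by congr chain_ideal; apply: val_inj; rewrite /= inordK. Qed.

Lemma chain_nat_widen n (A : ring_chain n.+1) (i : 'I_n.+1) :
  chain_ideal A (widen_ord (leqnSn n.+1) i) = chain_nat A i.
Proof.
congr chain_ideal; apply: val_inj; rewrite /= inordK //.
exact: leq_trans (ltn_ord i) _.
Qed.

Lemma chain_comp_param n (A : ring_chain n) x : param_chain n (chain_nat A) x ->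
  exists y, param_chain n (chain_nat (chain_comp A)) y.
Proof.
move=> pc; rewrite /chain_nat /chain_comp /=.
by rewrite chain_nat_max; eexists; apply: (completion_param_chain pc).
Qed.

Lemma chain_loc_param n (A : ring_chain n.+1) x :
  param_chain n.+1 (chain_nat A) x ->
  exists y, param_chain n (chain_nat (chain_loc A)) y.
Proof.
move=> pc; rewrite /chain_nat /chain_loc /=.
rewrite chain_nat_widen /=; eexists.
apply: param_chain_ext (localization_param_chain pc) => i lin.
by rewrite chain_nat_widen inordK.
Qed.

Lemma chain_comp_corr n (A : ring_chain n.+1) (B : ring_chain n) x y R :
  param_chain n.+1 (chain_nat A) x -> param_chain n (chain_nat B) y ->
  chain_corr n (chain_nat A) (chain_nat B) R ->
  exists R', chain_corr n (chain_nat (chain_comp A)) (chain_nat (chain_comp B))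
    R'.
Proof.
move=> pcA pcB RP; rewrite /chain_nat /chain_comp /=.
by rewrite !chain_nat_max; eexists; apply: (completion_corr pcA pcB RP).
Qed.

Lemma chain_loc_corr n (A : ring_chain n.+2) (B : ring_chain n.+1) x y R :
  param_chain n.+2 (chain_nat A) x -> param_chain n.+1 (chain_nat B) y ->
  chain_corr n.+1 (chain_nat A) (chain_nat B) R ->
  exists R', chain_corr n (chain_nat (chain_loc A)) (chain_nat (chain_loc B))
    R'.
Proof.
move=> pcA pcB RP; rewrite /chain_nat /chain_loc /=.
rewrite !chain_nat_widen /=; have [corrR RE] := localization_corr pcA pcB RP.
eexists; split; first exact: corrR.
move=> i f g lin fg; rewrite !chain_nat_widen !inordK ?ltnS ?leqW //.
exact: RE.
Qed.

(** Each round of completion and localisation shortens both chains and keeps them in correspondence.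
    After [n] rounds [B] has length zero, where [HL] is the identity, and [A] has one round left,
    treated by [completion_fraction_residue]. *)
Lemma HL_residue n (A : ring_chain n.+1) (B : ring_chain n) x y R :
  param_chain n.+1 (chain_nat A) x -> param_chain n (chain_nat B) y ->
  chain_corr n (chain_nat A) (chain_nat B) R ->
  cdvf (HL A) /\ ring_iso (residue (HL A)) (HL B).
Proof.
elim: n A B x y R => [|n IHn] A B x y R pcA pcB RP.
  rewrite /HL /chain_loc /chain_comp /= chain_nat_max chain_nat_widen.
  exact: (completion_fraction_residue pcA pcB RP).
have [x1 pcA1] := chain_comp_param pcA; have [x2 pcA2] := chain_loc_param pcA1.
have [y1 pcB1] := chain_comp_param pcB; have [y2 pcB2] := chain_loc_param pcB1.
have [R1 RP1] := chain_comp_corr pcA pcB RP.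
have [R2 RP2] := chain_loc_corr pcA1 pcB1 RP1.
exact: IHn pcA2 pcB2 RP2.
Qed.

Lemma HL_field n (A : ring_chain n) x :
  param_chain n (chain_nat A) x -> is_field_chain (HL A).
Proof.
elim: n A x => [|n IHn] A x pc.
  have [Af p0] := param_chain0_field pc; split=> //.
  by rewrite -p0 -chain_nat_max; congr (ideal_set (chain_ideal A _));
    apply: val_inj.
have [x1 pc1] := chain_comp_param pc; have [x2 pc2] := chain_loc_param pc1.
exact: IHn pc2.
Qed.

(** * The quotient chain and the induction on the length *)

Definition chain_quotient n (A : ring_chain n.+1) : ring_chain n :=
  @RingChain n (quotient_ring (chain_nat A 1))
    (fun i => quotient_im (chain_nat A 1) (chain_nat A i.+1)).

Lemma chain_quotient_ideal n (A : ring_chain n.+1) x i a :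
  param_chain n.+1 (chain_nat A) x -> (i <= n)%N ->
  chain_nat (chain_quotient A) i (quotient_map _ a) <-> chain_nat A i.+1 a.
Proof.
move=> pc lin; rewrite {1}/chain_nat /= inordK //; split=> [|pa];
  last by exists a.
apply: quotient_im_mem; apply: (chain_le (pc_succ pc)).
by rewrite ltnS.
Qed.

Lemma chain_quotient_param n (A : ring_chain n.+1) x :
  param_chain n.+1 (chain_nat A) x ->
  param_chain n (chain_nat (chain_quotient A)) (fun i =>
    quotient_map _ (x i.+1)).
Proof.
move=> pc; have E i a := @chain_quotient_ideal n A x i a pc.
split.
- move=> r; have [a <-] := quotient_map_surj r.
  by move=> /(E _ _ (leq0n n)) pa; apply/quotient_map_eq0.
- move=> i lin; apply/seteqP; split=> r; have [a <-] := quotient_map_surj r.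
    move=> /(E _ _ lin); rewrite (pc_succ pc) // => -[b pab].
    exists (quotient_map _ b); rewrite -rmorphM -rmorphB.
    exact/(E _ _ (ltnW lin)).
  move=> [s]; have [b <-] := quotient_map_surj s.
  rewrite -rmorphM -rmorphB => /(E _ _ (ltnW lin)) pab.
  by apply/(E _ _ lin); rewrite (pc_succ pc) //; exists b.
- move=> i lin; have [p1 pM] := pc_prime pc (i := i.+1) lin.
  split=> [|r s]; first by rewrite -(rmorph1 (quotient_map _)) => /(E _ _ lin).
  have [a <-] := quotient_map_surj r; have [b <-] := quotient_map_surj s.
  by rewrite -rmorphM => /(E _ _ lin)/pM[]/(E _ _ lin); [left|right].
- by move=> i lin /(E _ _ (ltnW lin)); apply: (pc_notin pc).
- move=> r; have [a <-] := quotient_map_surj r => na.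
  have [|b pb] := pc_field pc (a := a); first by move=> /(E _ _ (leqnn n)).
  exists (quotient_map _ b);
    rewrite -rmorphM -(rmorph1 (quotient_map _)) -rmorphB.
  exact/(E _ _ (leqnn n)).
Qed.

Lemma chain_quotient_corr n (A : ring_chain n.+1) x :
  param_chain n.+1 (chain_nat A) x ->
  chain_corr n (chain_nat A) (chain_nat (chain_quotient A))
    (fun a r => quotient_map _ a = r).
Proof.
move=> pc; split; last first.
  by move=> i a _ lin <-; apply: iff_sym; apply: chain_quotient_ideal pc lin.
split.
- by move=> a; exists (quotient_map _ a).
- exact: quotient_map_surj.
- exact: rmorph1.
- by move=> a _ a' _ <- <-; rewrite rmorphB.
- by move=> a _ a' _ <- <-; rewrite rmorphM.
Qed.

Lemma HL_cdvdim n (A : ring_chain n) x : param_chain n (chain_nat A) x ->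
  cdvdim_ge (HL A) n /\
  ring_iso (residue_field n (HL A)) (quotient_ring (chain_nat A n)).
Proof.
elim: n A x => [|n IHn] A x pc.
  split; first by rewrite /cdvdim_ge; case: (cdvdim _).
  have p0 a : chain_nat A 0 a -> a = 0 := pc_zero pc (a := a).
  apply: (@corr_iso _ _ (fun a r => quotient_map (chain_nat A 0) a = r)).
    split.
    - by move=> a; exists (quotient_map _ a).
    - exact: quotient_map_surj.
    - exact: rmorph1.
    - by move=> a _ a' _ <- <-; rewrite rmorphB.
    - by move=> a _ a' _ <- <-; rewrite rmorphM.
  move=> a _ <-; rewrite quotient_map_eq0; split=> [->|/p0 //].
  exact: ideal0.
have pcB := chain_quotient_param pc; have RP := chain_quotient_corr pc.
have [cA AB] := HL_residue pc pcB RP.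
have [dB resB] := IHn _ _ pcB.
have [dA resA] := cdvdim_ge_succ cA AB dB; split=> //.
(* What remains is the third isomorphism theorem for [chain_nat A 1] inside [chain_nat A n.+1]. *)
apply: ring_iso_trans resA (ring_iso_trans resB _).
apply: ring_iso_sym.
apply: (@corr_iso _ _ (fun r s => exists2 a : A, quotient_map _ a = r &
  quotient_map _ (quotient_map _ a) = s)).
  split.
  - move=> r; have [a ar] := quotient_map_surj r.
    by exists (quotient_map _ (quotient_map _ a)), a.
  - move=> s; have [r rs] := quotient_map_surj s;
    have [a ar] := quotient_map_surj r.
    by exists (quotient_map _ a), a; rewrite // ar.
  - by exists 1; rewrite ?rmorph1.
  - by move=> _ _ _ _ [a <- <-] [b <- <-]; exists (a - b); rewrite ?rmorphB.
  - by move=> _ _ _ _ [a <- <-] [b <- <-]; exists (a * b); rewrite ?rmorphM.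
move=> _ _ [a <- <-]; rewrite !quotient_map_eq0.
by apply: iff_sym; apply: chain_quotient_ideal pc (leqnn n).
Qed.

Theorem theorem6p7 (n : nat) (A : ring_chain n) (regA : regular_chain A) :
  [/\ is_field_chain (HL A),
      cdvdim_ge (HL A) n
    & ring_iso (residue_field n (HL A)) (quotient_ring (chain_ideal A ord_max))].
Proof.
have [x pc] := regular_chain_param regA.
have [dA resA] := HL_cdvdim pc.
by split=> //; [apply: HL_field pc | rewrite chain_nat_max].
Qed.
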